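(* (Sphere.) Let $\alpha\ge2$ be a real number. On the unit sphere $\mathbb S^n\subset\mathbb R^{n+1}$, the cost $\mathsf c(x,\bar x)=\mathsf u(s)$, $s=x^{\mathsf T}\bar x$, with $\mathsf u:[-1,1]\to[-2^{1/\alpha},0]$, $\mathsf u(s)=-(1+s)^{1/\alpha}$ (with inverse $\mathsf s(u)=(-u)^\alpha-1$ for $u\in[-2^{1/\alpha},0]$), satisfies A3s on $S_*:=\mathbb S^n\times\mathbb S^n\setminus\{(x,-x): x\in\mathbb S^n\}$. (Hyperboloid.) Let $\beta\in[1,2]$. On $\mathbb H^n$, the cost $\mathsf c(x,\bar x)=-(-x^{\mathfrak t}\bar x)^\beta$, corresponding to $\mathsf u:(-\infty,-1]\to(-\infty,-1]$ with $\mathsf u(s)=-(-s)^\beta$ and inverse $\mathsf s(u)=-(-u)^{1/\beta}$, is strictly regular, i.e. satisfies A3s on $\mathbb H^n\times\mathbb H^n$.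
   Context: On $\mathbb R^{n+1}$ put $x^{\mathfrak t}y:=-x_0y_0+\sum_{i=1}^nx_iy_i$; the hyperboloid model is $\mathbb H^n=\{x\in\mathbb R^{n+1}: x^{\mathfrak t}x=-1,\ x_0>0\}$, and $x^{\mathfrak t}\bar x\le-1$ for $x,\bar x\in\mathbb H^n$. Let $\mathsf c$ be a $C^4$ function on an open subset $\mathcal N$ of $\mathcal M\times\bar{\mathcal M}$, with $\mathcal M,\bar{\mathcal M}$ manifolds of the same dimension. The Kim-McCann pairing on $T\mathcal N$ is $\langle(\omega_1,\bar\omega_1),(\omega_2,\bar\omega_2)\rangle_{KM}=-\frac12(D_{\omega_1}\bar D_{\bar\omega_2}\mathsf c+\bar D_{\bar\omega_1}D_{\omega_2}\mathsf c)$, where $D$, $\bar D$ denote directional derivatives in the first and second variable; it is required to be nondegenerate. In local coordinates $x^i$ on $\mathcal M$ and $\bar x^{j}$ on $\bar{\mathcal M}$, with unbarred (barred) subscripts of $\mathsf c$ denoting partial derivatives in $x$ (in $\bar x$) and $(\mathsf c^{a\bar f})$ the inverse of the matrix $(\mathsf c_{a\bar f})$ (i.e. $\sum_f\mathsf c^{a\bar f}\mathsf c_{b\bar f}=\delta^a_b$), the cross-curvature (MTW tensor) at $\mathring\omega=(\omega,\bar\omega)$ is $$\mathrm{cross}(\mathring\omega)=\frac12\sum_{i,l,j,k}\omega^i\omega^l\bar\omega^{j}\bar\omega^{k}\Big(\sum_{a,f}\mathsf c_{il\bar f}\,\mathsf c^{a\bar f}\,\mathsf c_{a\bar j\bar k}-\mathsf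 c_{il\bar j\bar k}\Big),$$ which does not depend on the coordinates. A tangent vector $\mathring\omega=(\omega,\bar\omega)$ is null if $\langle\mathring\omega,\mathring\omega\rangle_{KM}=0$. A3w: $\mathrm{cross}(\mathring\omega)\ge0$ for every null vector at every point of $\mathcal N$. A3s (strict regularity): A3w holds, and $\mathrm{cross}(\mathring\omega)=0$ for a null vector implies $\omega=0$ or $\bar\omega=0$. *)

(* Defs.v *)
From HB Require Import structures.
From mathcomp Require Import all_boot all_order all_algebra.
From mathcomp Require Import all_classical all_reals all_analysis.
Import Order.TTheory GRing.Theory Num.Theory.
Import numFieldNormedType.Exports.

Set Implicit Arguments.
Unset Strict Implicit.
Unset Printing Implicit Defensive.

Local Open Scope classical_set_scope.
Local Open Scope ring_scope.

(* Meant for [U] open and [V] finite-dimensional, where continuity of all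
   iterated directional derivatives up to order k is the usual C^k property. *)
Fixpoint Ck (R : realType) (V W : normedModType R) (k : nat) (U : set V)
    (f : V -> W) : Prop :=
  (forall x, U x -> {for x, continuous f}) /\
  if k is k'.+1 then
    forall v : V, (forall x, U x -> derivable f x v) /\ Ck k' U ('D_v f)
  else True.

Definition smooth (R : realType) (V W : normedModType R) (U : set V)
    (f : V -> W) : Prop :=
  forall k, Ck k U f.

(* [phi], restricted to the open set [U] of R^n, is the inverse of a local
   coordinate system of the n-dimensional submanifold [M] of R^m: a smooth
   immersion that is a homeomorphism onto a relatively open subset of [M]. *)
Definition local_param (R : realType) (n m : nat) (M : set 'rV[R]_m)
    (U : set 'rV[R]_n) (phi : 'rV[R]_n -> 'rV[R]_m) : Prop :=
  [/\ open U,
      smooth U phi,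
      forall y, U y -> injective (fun v => 'D_v phi y),
      set_inj U phi
    & forall V, open V -> V `<=` U ->
        exists2 W, open W & phi @` V = M `&` W].

Definition submanifold (R : realType) (n m : nat) (M : set 'rV[R]_m) : Prop :=
  forall x, M x -> exists U (phi : 'rV[R]_n -> 'rV[R]_m),
    local_param M U phi /\ (phi @` U) x.

(* Below, [C] is a cost read in local coordinates; the tangent vector
   (omega, omegabar) is the pair [w] of its component vectors, so that D_omega
   and \bar D_omegabar are ['D_(w.1, 0)] and ['D_(0, w.2)]. *)
Section LocalCoordinates.
Variables (R : realType) (n : nat).
Implicit Types (C : 'rV[R]_n * 'rV[R]_n -> R) (p w : 'rV[R]_n * 'rV[R]_n).

Definition KM C p w1 w2 : R :=
  - 2^-1 * ('D_(w1.1, 0) ('D_(0, w2.2) C) p + 'D_(0, w1.2) ('D_(w2.1, 0) C) p).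

Definition KM_nondegenerate C p : Prop :=
  forall w1, (forall w2, KM C p w1 w2 = 0) -> w1 = 0.

Definition null_vector C p w : Prop := KM C p w w = 0.

Definition pd (i : 'I_n) C : 'rV[R]_n * 'rV[R]_n -> R :=
  'D_(delta_mx 0 i, 0) C.

Definition pdbar (j : 'I_n) C : 'rV[R]_n * 'rV[R]_n -> R :=
  'D_(0, delta_mx 0 j) C.

Definition mixed_hessian C p : 'M[R]_n := \matrix_(a, f) pd a (pdbar f C) p.

(* The transpose comes from the convention
   \sum_f c^{a fbar} c_{b fbar} = delta^a_b. *)
Definition mixed_hessian_inv C p : 'M[R]_n := invmx (mixed_hessian C p)^T.

Definition cross C p w : R :=
  2^-1 * \sum_(i < n) \sum_(l < n) \sum_(j < n) \sum_(k < n)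
    w.1 0 i * w.1 0 l * w.2 0 j * w.2 0 k *
    (\sum_(a < n) \sum_(f < n)
        pd i (pd l (pdbar f C)) p * mixed_hessian_inv C p a f *
        pd a (pdbar j (pdbar k C)) p
     - pd i (pd l (pdbar j (pdbar k C))) p).

End LocalCoordinates.

Section Cost.
Variables (R : realType) (n m mbar : nat).
Variables (M : set 'rV[R]_m) (Mbar : set 'rV[R]_mbar).
Variables (N : set ('rV[R]_m * 'rV[R]_mbar)).
Variable c : 'rV[R]_m -> 'rV[R]_mbar -> R.

Definition in_coordinates (phi : 'rV[R]_n -> 'rV[R]_m)
    (phibar : 'rV[R]_n -> 'rV[R]_mbar) : 'rV[R]_n * 'rV[R]_n -> R :=
  fun p => c (phi p.1) (phibar p.2).

Definition coordinate_domain (U : set 'rV[R]_n) (phi : 'rV[R]_n -> 'rV[R]_m)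
    (Ubar : set 'rV[R]_n) (phibar : 'rV[R]_n -> 'rV[R]_mbar) :
    set ('rV[R]_n * 'rV[R]_n) :=
  (U `*` Ubar) `&` [set p | N (phi p.1, phibar p.2)].

Definition C4_cost : Prop :=
  forall U phi Ubar phibar,
    local_param M U phi -> local_param Mbar Ubar phibar ->
    Ck 4 (coordinate_domain U phi Ubar phibar) (in_coordinates phi phibar).

(* [P] holds at every point of [N], in all local coordinates around it. *)
Definition everywhere
    (P : ('rV[R]_n * 'rV[R]_n -> R) -> 'rV[R]_n * 'rV[R]_n -> Prop) : Prop :=
  forall U phi Ubar phibar,
    local_param M U phi -> local_param Mbar Ubar phibar ->
    forall p, coordinate_domain U phi Ubar phibar p ->
      P (in_coordinates phi phibar) p.

Definition KM_cost : Prop :=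
  [/\ submanifold n M,
      submanifold n Mbar,
      exists2 W, open W & N = (M `*` Mbar) `&` W,
      C4_cost
    & everywhere (@KM_nondegenerate R n)].

Definition A3w : Prop :=
  everywhere (fun C p => forall w, null_vector C p w -> 0 <= cross C p w).

Definition A3s : Prop :=
  A3w /\
  everywhere (fun C p => forall w,
    null_vector C p w -> cross C p w = 0 -> w.1 = 0 \/ w.2 = 0).

End Cost.

(* The dimension [n] of the manifolds is not determined by the sets. *)
Arguments KM_cost {R} n {m mbar} M Mbar N c.
Arguments A3w {R} n {m mbar} M Mbar N c.
Arguments A3s {R} n {m mbar} M Mbar N c.

Definition mutually_inverse (T T' : Type) (A : set T) (B : set T')
    (f : T -> T') (g : T' -> T) : Prop :=
  [/\ set_fun A B f, set_fun B A g, {in A, cancel f g} & {in B, cancel g f}].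

Section Models.
Variables (R : realType) (n : nat).
Implicit Types x y : 'rV[R]_n.+1.

Definition dot x y : R := \sum_(i < n.+1) x 0 i * y 0 i.

Definition lorentz x y : R :=
  - (x 0 ord0 * y 0 ord0) + \sum_(i < n) x 0 (lift ord0 i) * y 0 (lift ord0 i).

Definition sphere : set 'rV[R]_n.+1 := [set x | dot x x = 1].

Definition hyperboloid : set 'rV[R]_n.+1 :=
  [set x | lorentz x x = -1 /\ 0 < x 0 ord0].

Definition sphere_star : set ('rV[R]_n.+1 * 'rV[R]_n.+1) :=
  (sphere `*` sphere) `\` [set (x, - x) | x in sphere].

End Models.

Arguments sphere R n : clear implicits.
Arguments hyperboloid R n : clear implicits.
Arguments sphere_star R n : clear implicits.

Section Profiles.
Variable R : realType.
Implicit Types alpha beta s u : R.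

Definition sphere_u alpha s : R := - ((1 + s) `^ alpha^-1).
Definition sphere_s alpha u : R := (- u) `^ alpha - 1.

Definition hyperboloid_u beta s : R := - ((- s) `^ beta).
Definition hyperboloid_s beta u : R := - ((- u) `^ beta^-1).

End Profiles.

Definition sphere_cost (R : realType) (n : nat) (alpha : R)
    (x xbar : 'rV[R]_n.+1) : R :=
  sphere_u alpha (dot x xbar).

Definition hyperboloid_cost (R : realType) (n : nat) (beta : R)
    (x xbar : 'rV[R]_n.+1) : R :=
  hyperboloid_u beta (lorentz x xbar).

(* Main.v *)
(* Both spaces are {x | <x, x> = K} for the form
   <x, y> = K x_0 y_0 + x_1 y_1 + ... + x_n y_n with K = 1 or K = -1, and both
   costs are u(<x, y>) with u(s) = - (a + K s)^r.

   For vectors xi and xib tangent at x and y, the mixed Hessian is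
   u''<xi, y><x, xib> + u'<xi, xib>.  Testing it against y - K <x, y> x (or
   x - K <x, y> y) inverts it explicitly, so the vector q contracting
   c_{omega omega fbar} with c^{a fbar} is a combination of the second
   derivative of the chart, x, xi and y, and the cross-curvature becomes a
   polynomial in s = <x, y>, X = <xi, xi>, Y = <xib, xib>, A = <xi, y>^2,
   B = <x, xib>^2: for a null vector it is a positive multiple of
     (1 + g s) X Y - d g (X B + A Y) / t - d g (2 g (g s + d) - d) A B / t^2,
     with g = 1/alpha, d = 1 - g, t = 1 + s, on the sphere, and of
     S X Y - d (X B + A Y) / S + d (2 (1 + d) D + d) A B / S^3,
     with d = beta - 1, S = -s, D = (1 + d) s^2 - d, on the hyperboloid.
   Tangent spaces are positive definite, so the Cauchy-Schwarz inequality gives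
   A <= X K (1 - s^2) and B <= Y K (1 - s^2).  Writing X and Y as the
   corresponding multiples of A and B plus nonnegative remainders, all
   coefficients become positive, which gives strict regularity. *)

Require Import Defs.
From mathcomp Require Import all_boot all_order all_algebra.
From mathcomp Require Import all_classical all_reals all_analysis.
From mathcomp Require Import ring lra.
Import Order.TTheory GRing.Theory Num.Theory.
Import numFieldNormedType.Exports.

Set Implicit Arguments.
Unset Strict Implicit.
Unset Printing Implicit Defensive.

Local Open Scope classical_set_scope.
Local Open Scope ring_scope.

(** * Directional derivatives and C^k functions *)

Section DirectionalDerivatives.
Variable R : realType.
Implicit Types V W : normedModType R.

Lemma open_near_eq V (T : Type) (U : set V) (f g : V -> T) x :
  open U -> U x -> {in U, f =1 g} -> \near x, f x = g x.
Proof.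
move=> oU Ux fg; apply: filterS (open_nbhs_nbhs (conj oU Ux)) => y Uy.
by apply: fg; rewrite inE.
Qed.

Lemma open_eq_is_derive V W (U : set V) (f g : V -> W) x v df :
  open U -> U x -> {in U, f =1 g} -> is_derive x v g df -> is_derive x v f df.
Proof.
move=> oU Ux fg; apply: near_eq_is_derive.
by apply: (open_near_eq oU Ux) => y Uy; rewrite fg.
Qed.

Lemma open_eq_derive V W (U : set V) (f g : V -> W) x v :
  open U -> U x -> {in U, f =1 g} -> 'D_v f x = 'D_v g x.
Proof. by move=> oU Ux fg; apply: near_eq_derive; exact: (open_near_eq oU Ux). Qed.

Lemma is_derive_addf V W (f g : V -> W) x v df dg :
  is_derive x v f df -> is_derive x v g dg ->
  is_derive x v (fun y => f y + g y) (df + dg).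
Proof. exact: is_deriveD. Qed.

Lemma is_derive_mulf V (f g : V -> R) x v df dg :
  is_derive x v f df -> is_derive x v g dg ->
  is_derive x v (fun y => f y * g y) (f x * dg + df * g x).
Proof.
by move=> hf hg; apply: (is_derive_eq (is_deriveM hf hg)); rewrite [df * _]mulrC.
Qed.

Lemma is_derive_sumf V W (I : Type) (r : seq I) (P : pred I) (F : I -> V -> W)
    x v (dF : I -> W) :
  (forall i, P i -> is_derive x v (F i) (dF i)) ->
  is_derive x v (fun y => \sum_(i <- r | P i) F i y) (\sum_(i <- r | P i) dF i).
Proof.
move=> hF; elim: r => [|i r IH].
  by under eq_fun do rewrite big_nil; rewrite big_nil; exact: is_derive_cst.
under eq_fun do rewrite big_cons; rewrite big_cons; case: ifPn => // Pi.
by apply: is_derive_addf => //; exact: hF.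
Qed.

(** Restriction to a line makes the one-variable calculus applicable to directional derivatives. *)
Lemma derive_line0 V W (f : V -> W) x v :
  'D_v f x = 'D_1 (fun h : R => f (h *: v + x)) 0.
Proof.
rewrite /derive; set g1 := fun h => h^-1 *: _; set g2 := fun h => h^-1 *: _.
suff -> : g1 = g2 by [].
by apply/funext => h; rewrite /g1 /g2 /= addr0 scale0r add0r [_%:A]mulr1.
Qed.

(** Derivability is assumed in the single direction [v], so the chain rule is applied to the
    restriction [F] of [f] to the line through [x]. *)
Lemma is_derive_compf V (f : V -> R) (g : R -> R) x v df dg :
  is_derive x v f df -> is_derive (f x) 1 g dg ->
  is_derive x v (fun y => g (f y)) (dg * df).
Proof.
move=> [hf <-] [hg <-]; pose F h := f (h *: v + x).
have F0 : F 0 = f x by rewrite /F scale0r add0r.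
have dF : derivable F 0 1 by move/derivable1P : hf.
have dgF : derivable g (F 0) 1 by rewrite F0.
split.
  apply/derivable1P/derivable1_diffP.
  have : differentiable (g \o F) (0 : R).
    by apply: differentiable_comp; exact/derivable1_diffP.
  by [].
rewrite (derive_line0 (fun y => g (f y))) (derive_line0 f) -F0 -!derive1E.
by rewrite -derive1_comp.
Qed.

(** By linearity of [L] both sides are limits of the same difference quotient. *)
Lemma derive_comp_linear V V' W (L : V' -> V) (f : V -> W) x v :
  (forall h y z, L (h *: y + z) = h *: L y + L z) ->
  'D_v (f \o L) x = 'D_(L v) f (L x).
Proof.
by move=> Llin; rewrite /derive; under eq_fun do rewrite /= Llin.
Qed.

Lemma derivable_comp_linear V V' W (L : V' -> V) (f : V -> W) x v :
  (forall h y z, L (h *: y + z) = h *: L y + L z) ->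
  derivable (f \o L) x v <-> derivable f (L x) (L v).
Proof.
by move=> Llin; rewrite /derivable; under eq_fun do rewrite /= Llin.
Qed.

Lemma is_derive_comp_linear V V' W (L : V' -> V) (f : V -> W) x v df :
  (forall h y z, L (h *: y + z) = h *: L y + L z) ->
  is_derive (L x) (L v) f df -> is_derive x v (f \o L) df.
Proof.
move=> Llin [h1 h2].
by split; [exact/derivable_comp_linear|rewrite derive_comp_linear].
Qed.

Lemma is_derive_line V W (f : V -> W) x v (s : R) df :
  is_derive (x + s *: v) v f df -> is_derive s 1 (fun t => f (x + t *: v)) df.
Proof.
have E : (fun h : R => h^-1 *: (((fun t => f (x + t *: v)) \o shift s) h%:A -
    f (x + s *: v))) =
  (fun h => h^-1 *: ((f \o shift (x + s *: v)) (h *: v) - f (x + s *: v))).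
  apply/funext => h /=; rewrite [_%:A]mulr1 scalerDl.
  by congr (_ *: (f _ - _)); rewrite addrCA.
by move=> [h1 h2]; split; rewrite /derivable /derive E.
Qed.

(** Chain rule for the reparametrization t -> a t of the line, which covers a = 0 without a case
    distinction. *)
Lemma is_deriveZdir V (f : V -> R) x v a df :
  is_derive x v f df -> is_derive x (a *: v) f (a * df).
Proof.
move=> h; have h0 : is_derive (0 : R) 1 (fun t => f (x + t *: v)) df.
  by apply: is_derive_line; rewrite scale0r addr0.
pose L (t : R) := a *: t.
have h1 : is_derive (0 : R) 1 (fun t => f (x + L t *: v)) (df * a).
  apply: (@is_derive_compf _ L (fun t => f (x + t *: v))).
    by apply: (is_derive_eq (is_deriveZ a (is_derive_id (0 : R) 1))); exact: mulr1.
  by rewrite /L scaler0.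
move: h1 => [h1 h2].
have E : (fun h : R => h^-1 *: (((fun t => f (x + L t *: v)) \o shift 0) h%:A -
    f (x + L 0 *: v))) =
  (fun h => h^-1 *: ((f \o shift x) (h *: (a *: v)) - f x)).
  apply/funext => t /=; rewrite addr0 [t%:A]mulr1 /L scaler0 scale0r addr0.
  by rewrite [_ + x]addrC scalerA [t * a]mulrC.
by split; [move: h1|move: h2]; rewrite /derivable /derive E // mulrC.
Qed.

(* By the mean value theorem along [v], the increment from [x + h w] to
   [x + h w + h v] is [h] times a value of ['D_v f] near [x]. *)
Lemma is_deriveDdir V (U : set V) (f : V -> R) x v w df :
  open U -> U x -> (forall y, U y -> derivable f y v) ->
  {for x, continuous ('D_v f)} -> is_derive x w f df ->
  is_derive x (v + w) f ('D_v f x + df).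
Proof.
move=> oU Ux dv cv dw.
suff : (fun h => h^-1 *: ((f \o shift x) (h *: (v + w)) - f x)) @ 0^' -->
    'D_v f x + df.
  by move=> h; split; [apply/cvg_ex; exists ('D_v f x + df)|exact: cvg_lim h].
have [h1 h2] := dw.
have {h1}h1 : (fun h => h^-1 *: ((f \o shift x) (h *: w) - f x)) @ 0^' --> df.
  by rewrite -h2; exact: h1.
suff h3 : (fun h => h^-1 *: (f (h *: (v + w) + x) - f (h *: w + x))) @ 0^' -->
    'D_v f x.
  apply: (cvg_trans _ (cvgD h3 h1)); apply: near_eq_cvg.
  by near=> h => /=; rewrite -[LHS]scalerDr addrA subrK.
apply/cvgrPdist_le => e e0.
have /nbhs_ballP[r /= r0 hr] : nbhs x (U `&` [set y | `|'D_v f x - 'D_v f y| <= e]).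
  apply: filterI; first exact: open_nbhs_nbhs.
  by move/cvgrPdist_le : cv => /(_ e e0).
near=> h.
have inball t : 0 <= t <= 1 -> ball x r ((x + h *: w) + t *: (h *: v)).
  move=> /andP[t0 t1]; rewrite -ball_normE /= -addrA opprD addNKr normrN.
  rewrite (le_lt_trans (ler_normD _ _)) // !normrZ (ger0_norm t0).
  rewrite (@le_lt_trans _ _ (`|h| * (`|w| + `|v|))) //.
    rewrite mulrDr lerD2l mulrA ler_wpM2r // ler_piMl //.
  near: h.
  (* The summand 1 keeps the divisor positive when [v] and [w] both vanish. *)
  have c0 : 0 < `|w| + `|v| + 1 by rewrite ltr_wpDl // addr_ge0.
  near=> h; rewrite (@le_lt_trans _ _ (`|h| * (`|w| + `|v| + 1))) //.
    by rewrite ler_wpM2l // lerDl.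
  rewrite -ltr_pdivlMr //; near: h; apply: dnbhs0_lt; exact: divr_gt0.
pose g (t : R) : R := f (x + h *: w + t *: (h *: v)).
pose dg (t : R) : R := h * 'D_v f (x + h *: w + t *: (h *: v)).
have hd (t : R) : t \in `[0, 1]%R -> is_derive t 1 g (dg t).
  rewrite in_itv /= => t01; apply: is_derive_line; apply: is_deriveZdir.
  by apply: derivableP; apply: dv; have [] := hr _ (inball _ t01).
have hdo (t : R) : t \in `]0, 1[%R -> is_derive t 1 g (dg t).
  by move=> t01; apply: hd; exact: subset_itv_oo_cc t01.
have gc : {within `[0, 1], continuous g}.
  by apply: derivable_within_continuous => t /hd[].
have [c c01] := MVT ltr01 hdo gc.
rewrite /g /dg.
rewrite scale1r scale0r addr0 subr0 mulr1 => E.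
have h0 : h != 0 by near: h; exact: nbhs_dnbhs_neq.
rewrite [h *: (v + w)]scalerDr -addrA [h *: v + _]addrC [h *: w + x]addrC E.
rewrite [_ *: _]mulrA mulVf // mul1r.
have c01' : 0 <= c <= 1 by move: c01; rewrite in_itv /= => /andP[/ltW-> /ltW->].
exact: (hr _ (inball c c01')).2.
Unshelve. all: by end_near. Qed.

(** Linearity of the derivative in its direction. [Ck] speaks of directional derivatives only, so
    this rests on their continuity, through [is_deriveDdir], one summand at a time. *)
Lemma is_derive_sumdir V (U : set V) (f : V -> R) x (I : Type) (r : seq I)
    (c : I -> R) (d : I -> V) :
  open U -> U x -> Ck 1 U f ->
  is_derive x (\sum_(i <- r) c i *: d i) f (\sum_(i <- r) c i * 'D_(d i) f x).
Proof.
move=> oU Ux [_ Cf]; elim: r => [|i r IH].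
  by rewrite !big_nil; exact: is_derive0.
rewrite !big_cons.
have <- : 'D_(c i *: d i) f x = c i * 'D_(d i) f x.
  by apply: derive_val; apply: is_deriveZdir; apply: derivableP; exact: (Cf _).1.
apply: (is_deriveDdir oU Ux _ _ IH); first exact: (Cf _).1.
exact: (Cf _).2.1.
Qed.

Lemma derive_sumdir V (U : set V) (f : V -> R) x (I : Type) (r : seq I)
    (c : I -> R) (d : I -> V) :
  open U -> U x -> Ck 1 U f ->
  'D_(\sum_(i <- r) c i *: d i) f x = \sum_(i <- r) c i * 'D_(d i) f x.
Proof. by move=> oU Ux Cf; apply: derive_val; exact: is_derive_sumdir Cf. Qed.

Lemma Ck_continuous V W k (U : set V) (f : V -> W) x :
  Ck k U f -> U x -> {for x, continuous f}.
Proof. by case: k => [|k] [+ _]; apply. Qed.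

Lemma Ck_derivable V W k (U : set V) (f : V -> W) x v :
  Ck k.+1 U f -> U x -> derivable f x v.
Proof. by move=> [_ /(_ v)[+ _]]; apply. Qed.

Lemma Ck_derive V W k (U : set V) (f : V -> W) v :
  Ck k.+1 U f -> Ck k U ('D_v f).
Proof. by move=> [_ /(_ v)[]]. Qed.

Lemma CkW V W k (U : set V) (f : V -> W) : Ck k.+1 U f -> Ck k U f.
Proof.
elim: k f => [|k IH] f [h1 h2]; split=> // v.
by have [dv Cv] := h2 v; split=> //; exact: IH.
Qed.

Lemma Ck_subset V W k (U U' : set V) (f : V -> W) :
  U' `<=` U -> Ck k U f -> Ck k U' f.
Proof.
move=> sU; elim: k f => [|k IH] f Cf.
  by split=> // x U'x; apply: (Ck_continuous Cf); exact: sU.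
split=> [x U'x|v]; first exact: Ck_continuous Cf (sU _ U'x).
split=> [x U'x|]; first exact: Ck_derivable Cf (sU _ U'x).
exact: IH (Ck_derive v Cf).
Qed.

(** On an open set, equal functions are equal near each point and so have equal iterated
    derivatives. This lets the closure lemmas below use derivative formulas that hold on [U]
    only. *)
Lemma eq_Ck V W k (U : set V) (f g : V -> W) :
  open U -> {in U, f =1 g} -> Ck k U f -> Ck k U g.
Proof.
move=> oU; elim: k f g => [|k IH] f g fg Cf.
  split=> // x Ux; have fx := Ck_continuous Cf Ux.
  have nfg := open_near_eq oU Ux fg.
  suff : g @ x --> f x by rewrite (fg x) ?inE.
  by apply: cvg_trans fx; apply: near_eq_cvg; apply: filterS nfg => y ->.
split=> [x Ux|v]; first exact: Ck_continuous (IH _ _ fg (CkW Cf)) Ux.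
split=> [x Ux|].
  apply: (near_eq_derivable _ (Ck_derivable Cf Ux)); exact: (open_near_eq oU Ux).
apply: IH (Ck_derive v Cf) => x; rewrite inE => Ux.
exact: open_eq_derive oU Ux fg.
Qed.

Lemma Ck_cst V W k (U : set V) (c : W) : Ck k U (fun=> c).
Proof.
elim: k c => [|k IH] c; first by split=> // x Ux; exact: cst_continuous.
split=> [x Ux|v]; first exact: cst_continuous.
split=> [x Ux|]; first exact: derivable_cst.
by rewrite (_ : 'D_v _ = fun=> 0) //; apply/funext => x; exact: derive_cst.
Qed.

Lemma Ck_add V W k (U : set V) (f g : V -> W) :
  open U -> Ck k U f -> Ck k U g -> Ck k U (fun x => f x + g x).
Proof.
move=> oU; elim: k f g => [|k IH] f g Cf Cg.
  split=> // x Ux.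
  by apply: cvgD; [exact: (Ck_continuous Cf)|exact: (Ck_continuous Cg)].
split=> [x Ux|v]; first exact: Ck_continuous (IH _ _ (CkW Cf) (CkW Cg)) Ux.
split=> [x Ux|].
  by apply: derivableD; [exact: (Ck_derivable Cf)|exact: (Ck_derivable Cg)].
apply: eq_Ck (IH _ _ (Ck_derive v Cf) (Ck_derive v Cg)) => // x.
rewrite inE => Ux; apply/esym/derive_val; apply: is_derive_addf.
  by apply: derivableP; exact: (Ck_derivable Cf).
by apply: derivableP; exact: (Ck_derivable Cg).
Qed.

Lemma Ck_mul V k (U : set V) (f g : V -> R) :
  open U -> Ck k U f -> Ck k U g -> Ck k U (fun x => f x * g x).
Proof.
move=> oU; elim: k f g => [|k IH] f g Cf Cg.
  split=> // x Ux.
  by apply: cvgM; [exact: (Ck_continuous Cf)|exact: (Ck_continuous Cg)].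
split=> [x Ux|v]; first exact: Ck_continuous (IH _ _ (CkW Cf) (CkW Cg)) Ux.
split=> [x Ux|].
  by apply: derivableM; [exact: (Ck_derivable Cf)|exact: (Ck_derivable Cg)].
have C1 := IH _ _ (CkW Cf) (Ck_derive v Cg).
have C2 := IH _ _ (Ck_derive v Cf) (CkW Cg).
apply: eq_Ck (Ck_add oU C1 C2) => // x.
rewrite inE => Ux; apply/esym/derive_val; apply: is_derive_mulf.
  by apply: derivableP; exact: (Ck_derivable Cf).
by apply: derivableP; exact: (Ck_derivable Cg).
Qed.

Lemma Ck_sum V W k (U : set V) (I : Type) (r : seq I) (F : I -> V -> W) :
  open U -> (forall i, Ck k U (F i)) -> Ck k U (fun x => \sum_(i <- r) F i x).
Proof.
move=> oU CF; elim: r => [|i r IH].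
  by under eq_fun do rewrite big_nil; exact: Ck_cst.
by under eq_fun do rewrite big_cons; exact: Ck_add.
Qed.

(** Differentiation lowers the exponent, so the induction on [k] is uniform in [r]; positivity of
    [f] is what makes every real power differentiable. *)
Lemma Ck_powR V k (U : set V) (f : V -> R) r :
  open U -> (forall x, U x -> 0 < f x) -> Ck k U f ->
  Ck k U (fun x => f x `^ r).
Proof.
move=> oU f0; elim: k r => [|k IH] r Cf.
  split=> // x Ux; apply: (@continuous_comp _ _ _ f (fun t => t `^ r)).
    exact: (Ck_continuous Cf).
  apply/differentiable_continuous/derivable1_diffP/ex_derive.
  exact: is_derive1_powR (f0 x Ux).
have d x v : U x ->
    is_derive x v (fun x => f x `^ r) (r * f x `^ (r - 1) * 'D_v f x).
  move=> Ux; apply: (@is_derive_compf _ f (fun t => t `^ r)).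
    by apply: derivableP; exact: (Ck_derivable Cf).
  exact: is_derive1_powR (f0 x Ux).
split=> [x Ux|v]; first exact: Ck_continuous (IH r (CkW Cf)) Ux.
split=> [x Ux|]; first by apply: ex_derive; exact: d.
have C1 := Ck_mul oU (Ck_cst k U r) (IH (r - 1) (CkW Cf)).
apply: eq_Ck (Ck_mul oU C1 (Ck_derive v Cf)) => // x.
by rewrite inE => Ux; apply/esym/derive_val; exact: d.
Qed.

Lemma Ck_comp_linear V V' W k (U : set V) (f : V -> W) (L : V' -> V) :
  continuous L -> (forall h y z, L (h *: y + z) = h *: L y + L z) ->
  Ck k U f -> Ck k (L @^-1` U) (f \o L).
Proof.
move=> cL Llin; elim: k f => [|k IH] f Cf.
  split=> // x Ux.
  by apply: continuous_comp; [exact: cL|exact: (Ck_continuous Cf)].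
split=> [x Ux|v]; first exact: Ck_continuous (IH _ (CkW Cf)) Ux.
split=> [x Ux|]; first exact/derivable_comp_linear/(Ck_derivable Cf).
rewrite (_ : 'D_v _ = 'D_(L v) f \o L); first exact/IH/Ck_derive.
by apply/funext => x; rewrite derive_comp_linear.
Qed.

Lemma Ck_rowP V k n (U : set V) (f : V -> 'rV[R]_n) :
  open U -> Ck k U f <-> forall i, Ck k U (fun x => f x 0 i).
Proof.
move=> oU; elim: k f => [|k IH] f.
  split=> [Cf i|Cf].
    split=> // x Ux; apply: (@continuous_comp _ _ _ f (fun u : 'rV_n => u 0 i)).
      exact: (Ck_continuous Cf).
    exact: coord_continuous.
  split=> // x Ux; apply/cvgrPdist_le => e e0; near=> y.
  rewrite [leLHS]/Num.Def.normr /= mx_normrE bigmax_le ?(ltW e0) //= => -[i j] _.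
  rewrite !mxE /= ord1; move: j; near: y; apply: filter_forall => j.
  exact: ((cvgrPdist_le _ _).1 (Ck_continuous (Cf j) Ux)).
split=> [Cf i|Cf].
  split=> [x Ux|v].
    exact: Ck_continuous ((IH f).1 (CkW Cf) i) Ux.
  split=> [x Ux|]; first exact: ((derivable_mxP f x v).1 (Ck_derivable Cf Ux) 0 i).
  apply: eq_Ck ((IH _).1 (Ck_derive v Cf) i) => // x; rewrite inE => Ux.
  by rewrite (@derive_mx _ _ _ _ f x v (Ck_derivable Cf Ux)) mxE.
have df x v : U x -> derivable f x v.
  move=> Ux; apply/derivable_mxP => j i; rewrite ord1.
  exact: (Ck_derivable (Cf i) Ux).
split=> [x Ux|v].
  apply: (@Ck_continuous _ _ k U) => //; apply/IH => i; exact: CkW (Cf i).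
split=> [x Ux|]; first exact: df.
apply/IH => i; apply: eq_Ck (Ck_derive v (Cf i)) => // x; rewrite inE => Ux.
by rewrite (derive_mx (df _ _ Ux)) mxE.
Unshelve. all: by end_near. Qed.

End DirectionalDerivatives.

(** * The cross-curvature as an iterated directional derivative *)

Section CrossCurvature.
Variable R : realType.

Lemma derive_lincomb (V : normedModType R) (U : set V) (I : Type) (r : seq I)
    (a : I -> R) (F : I -> V -> R) x v :
  open U -> U x -> (forall i, Ck 1 U (F i)) ->
  'D_v (fun y => \sum_(i <- r) a i * F i y) x = \sum_(i <- r) a i * 'D_v (F i) x.
Proof.
move=> oU Ux CF; apply: derive_val; apply: is_derive_sumf => i _.
have dF := derivableP (Ck_derivable (v := v) (CF i) Ux).
apply: (is_derive_eq (is_derive_mulf (is_derive_cst (a i) x v) dF)).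
by rewrite mul0r addr0.
Qed.

Lemma derive2_lincomb (V : normedModType R) (U : set V) (I : Type) (r : seq I)
    (a : I -> R) (F : I -> V -> R) x v :
  open U -> U x -> (forall i, Ck 2 U (F i)) ->
  'D_v ('D_v (fun y => \sum_(i <- r) a i * F i y)) x =
  \sum_(i <- r) a i * 'D_v ('D_v (F i)) x.
Proof.
move=> oU Ux CF; rewrite -(derive_lincomb _ _ _ oU) => [|//|i]; last exact: Ck_derive.
apply: (open_eq_derive _ oU Ux) => y; rewrite inE => Uy.
by rewrite (derive_lincomb _ _ _ oU) // => i; exact: CkW.
Qed.

Lemma derive2_sumdir (V : normedModType R) (U : set V) (f : V -> R) x
    (I : Type) (r : seq I) (c : I -> R) (d : I -> V) :
  open U -> U x -> Ck 2 U f ->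
  'D_(\sum_(i <- r) c i *: d i) ('D_(\sum_(i <- r) c i *: d i) f) x =
  \sum_(i <- r) \sum_(l <- r) c i * c l * 'D_(d i) ('D_(d l) f) x.
Proof.
move=> oU Ux Cf; set s : V := \sum_(i <- r) c i *: d i.
have -> : 'D_s ('D_s f) x = 'D_s (fun y => \sum_(l <- r) c l * 'D_(d l) f y) x.
  apply: (open_eq_derive _ oU Ux) => y; rewrite inE => Uy.
  exact: (derive_sumdir _ _ _ oU Uy (CkW Cf)).
rewrite (derive_lincomb _ _ _ oU) // => [|l]; last exact: Ck_derive.
transitivity (\sum_(l <- r) \sum_(i <- r) c l * (c i * 'D_(d i) ('D_(d l) f) x)).
  apply: eq_bigr => l _.
  by rewrite (derive_sumdir r c d oU Ux (Ck_derive (d l) Cf)) mulr_sumr.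
rewrite [LHS]exchange_big /=; apply: eq_bigr => i _; apply: eq_bigr => l _.
by rewrite mulrCA mulrA.
Qed.

(** Regroups the sum in [cross] so that the matrix [M], the inverse mixed Hessian, is first applied
    to c_{omega omega fbar}. *)
Lemma contract_sums (I : finType) (u v : I -> R) (P : I -> I -> I -> R)
    (M : I -> I -> R) (Q : I -> I -> I -> R) :
  \sum_j \sum_k v j * v k *
    \sum_a (\sum_f (\sum_i \sum_l u i * u l * P i l f) * M a f) * Q a j k =
  \sum_i \sum_l \sum_j \sum_k u i * u l * v j * v k *
    \sum_a \sum_f P i l f * M a f * Q a j k.
Proof.
under [RHS]eq_bigr do rewrite exchange_big /=.
rewrite [RHS]exchange_big /=; apply: eq_bigr => j _.
under [RHS]eq_bigr do rewrite exchange_big /=.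
rewrite [RHS]exchange_big /=; apply: eq_bigr => k _.
rewrite mulr_sumr.
under [RHS]eq_bigr => i _ do under eq_bigr => l _ do rewrite mulr_sumr.
under [RHS]eq_bigr do rewrite exchange_big /=.
rewrite [RHS]exchange_big /=; apply: eq_bigr => a _.
under [RHS]eq_bigr => i _ do under eq_bigr => l _ do rewrite mulr_sumr.
under [RHS]eq_bigr do rewrite exchange_big /=.
rewrite [RHS]exchange_big /= mulr_suml mulr_sumr; apply: eq_bigr => f _.
rewrite !mulr_suml mulr_sumr; apply: eq_bigr => i _.
rewrite !mulr_suml mulr_sumr; apply: eq_bigr => l _.
ring.
Qed.

Variable n : nat.
Implicit Types (C : 'rV[R]_n * 'rV[R]_n -> R) (p w : 'rV[R]_n * 'rV[R]_n).
Implicit Types (O : set ('rV[R]_n * 'rV[R]_n)) (u v q : 'rV[R]_n).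

Lemma pair_sum_deltal u :
  (u, 0) = \sum_(i < n) u 0 i *: (delta_mx 0 i, 0) :> 'rV[R]_n * 'rV[R]_n.
Proof.
rewrite [LHS]surjective_pairing [RHS]surjective_pairing /=; congr pair.
  by rewrite (raddf_sum (@fst _ _)) [LHS]row_sum_delta.
by rewrite (raddf_sum (@snd _ _)) big1 // => i _ /=; rewrite scaler0.
Qed.

Lemma pair_sum_deltar u :
  (0, u) = \sum_(i < n) u 0 i *: (0, delta_mx 0 i) :> 'rV[R]_n * 'rV[R]_n.
Proof.
rewrite [LHS]surjective_pairing [RHS]surjective_pairing /=; congr pair.
  by rewrite (raddf_sum (@fst _ _)) big1 // => i _ /=; rewrite scaler0.
by rewrite (raddf_sum (@snd _ _)) [LHS]row_sum_delta.
Qed.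

Lemma sum_pd O C p u :
  open O -> O p -> Ck 1 O C -> \sum_i u 0 i * pd i C p = 'D_(u, 0) C p.
Proof. by move=> oO Op CC; rewrite pair_sum_deltal (derive_sumdir _ _ _ oO Op CC). Qed.

Lemma sum_pdbar O C p u :
  open O -> O p -> Ck 1 O C -> \sum_j u 0 j * pdbar j C p = 'D_(0, u) C p.
Proof. by move=> oO Op CC; rewrite pair_sum_deltar (derive_sumdir _ _ _ oO Op CC). Qed.

Lemma sum_pd2 O C p u :
  open O -> O p -> Ck 2 O C ->
  \sum_i \sum_l u 0 i * u 0 l * pd i (pd l C) p = 'D_(u, 0) ('D_(u, 0) C) p.
Proof. by move=> oO Op CC; rewrite pair_sum_deltal (derive2_sumdir _ _ _ oO Op CC). Qed.

Lemma sum_pdbar2 O C p u :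
  open O -> O p -> Ck 2 O C ->
  \sum_j \sum_k u 0 j * u 0 k * pdbar j (pdbar k C) p =
  'D_(0, u) ('D_(0, u) C) p.
Proof. by move=> oO Op CC; rewrite pair_sum_deltar (derive2_sumdir _ _ _ oO Op CC). Qed.

Lemma sum_pd2_pdbar2 O C p u v :
  open O -> O p -> Ck 4 O C ->
  \sum_i \sum_l \sum_j \sum_k u 0 i * u 0 l * v 0 j * v 0 k *
    pd i (pd l (pdbar j (pdbar k C))) p =
  'D_(u, 0) ('D_(u, 0) ('D_(0, v) ('D_(0, v) C))) p.
Proof.
move=> oO Op CC.
(* The barred derivatives are expanded on all of [O], since they are differentiated again, and the
   double sum becomes one over pairs to fit [derive2_lincomb]. *)
have -> : 'D_(u, 0) ('D_(u, 0) ('D_(0, v) ('D_(0, v) C))) p =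
    'D_(u, 0) ('D_(u, 0) (fun y => \sum_(jk : 'I_n * 'I_n)
      v 0 jk.1 * v 0 jk.2 * pdbar jk.1 (pdbar jk.2 C) y)) p.
  apply: (open_eq_derive _ oO Op) => y; rewrite inE => Oy.
  apply: (open_eq_derive _ oO Oy) => z; rewrite inE => Oz.
  rewrite -(sum_pdbar2 _ oO Oz (CkW (CkW CC))) pair_big /=.
  by apply: eq_bigr => -[].
rewrite (derive2_lincomb _ _ _ oO) // => [|jk]; last first.
  exact/Ck_derive/Ck_derive.
transitivity (\sum_(jk : 'I_n * 'I_n) \sum_i \sum_l v 0 jk.1 * v 0 jk.2 *
    (u 0 i * u 0 l * pd i (pd l (pdbar jk.1 (pdbar jk.2 C))) p)).
  rewrite [RHS]exchange_big /=; apply: eq_bigr => i _.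
  rewrite [RHS]exchange_big /=; apply: eq_bigr => l _.
  rewrite pair_big /=; apply: eq_bigr => -[j k] _ /=; ring.
apply: eq_bigr => jk _.
rewrite -(sum_pd2 _ oO Op); last exact/Ck_derive/Ck_derive.
rewrite mulr_sumr; apply: eq_bigr => i _.
by rewrite mulr_sumr.
Qed.

(** A row [u] killed by the mixed Hessian gives (u, 0) in the kernel of the pairing: one half of
    [KM] vanishes by the choice of [u], the other because its direction is zero. *)
Lemma KM_nondegenerate_unitmx O C p :
  open O -> O p -> Ck 2 O C -> KM_nondegenerate C p -> mixed_hessian C p \in unitmx.
Proof.
move=> oO Op CC nd; rewrite -row_free_unit; apply: inj_row_free => u uH0.
suff : (u, 0) = 0 :> 'rV[R]_n * 'rV[R]_n by case.
have uf f : 'D_(u, 0) (pdbar f C) p = 0.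
  rewrite -(sum_pd _ oO Op (Ck_derive _ CC)).
  transitivity ((u *m mixed_hessian C p) 0 f); last by rewrite uH0 mxE.
  by rewrite mxE; apply: eq_bigr => a _; rewrite !mxE.
apply: nd => w; rewrite /KM /= derive0 addr0.
have -> : 'D_(u, 0) ('D_(0, w.2) C) p =
    'D_(u, 0) (fun y => \sum_f w.2 0 f * pdbar f C y) p.
  apply: (open_eq_derive _ oO Op) => y; rewrite inE => Oy.
  by rewrite (sum_pdbar _ oO Oy (CkW CC)).
rewrite (derive_lincomb _ _ _ oO) // => [|f]; last exact: Ck_derive.
by rewrite big1 ?mulr0 // => f _; rewrite uf mulr0.
Qed.

(* [q] stands for the vector with components
   \sum_f c_{omega omega fbar} c^{a fbar}. *)
Lemma cross_derive O C p w q :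
  open O -> O p -> Ck 4 O C -> KM_nondegenerate C p ->
  (forall f, 'D_(q, 0) (pdbar f C) p = 'D_(w.1, 0) ('D_(w.1, 0) (pdbar f C)) p) ->
  cross C p w = 2^-1 * ('D_(q, 0) ('D_(0, w.2) ('D_(0, w.2) C)) p -
    'D_(w.1, 0) ('D_(w.1, 0) ('D_(0, w.2) ('D_(0, w.2) C))) p).
Proof.
move=> oO Op CC nd qE; rewrite /cross; congr (_ * _).
have C2 : Ck 2 O C by exact: CkW (CkW CC).
have Hu := KM_nondegenerate_unitmx oO Op C2 nd.
have qH : q *m mixed_hessian C p =
    \row_f 'D_(w.1, 0) ('D_(w.1, 0) (pdbar f C)) p.
  apply/rowP => f; rewrite !mxE -qE -(sum_pd _ oO Op (Ck_derive _ C2)).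
  by apply: eq_bigr => a _; rewrite !mxE.
(* Right multiplication of [qH] by the inverse Hessian; because of the transpose, the (a, f) entry
   of [mixed_hessian_inv] is the (f, a) entry of that inverse. *)
have {qE qH}qE a : \sum_f 'D_(w.1, 0) ('D_(w.1, 0) (pdbar f C)) p *
    mixed_hessian_inv C p a f = q 0 a.
  rewrite -[q](mulmxK Hu) qH !mxE; apply: eq_bigr => f _.
  by rewrite /mixed_hessian_inv -trmx_inv !mxE.
have E1 : 'D_(q, 0) ('D_(0, w.2) ('D_(0, w.2) C)) p =
    \sum_j \sum_k w.2 0 j * w.2 0 k * 'D_(q, 0) (pdbar j (pdbar k C)) p.
  transitivity ('D_(q, 0) (fun y => \sum_(jk : 'I_n * 'I_n)
      w.2 0 jk.1 * w.2 0 jk.2 * pdbar jk.1 (pdbar jk.2 C) y) p).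
    apply: (open_eq_derive _ oO Op) => y; rewrite inE => Oy.
    rewrite -(sum_pdbar2 w.2 oO Oy C2) pair_big /=.
    by apply: eq_bigr => -[].
  rewrite (derive_lincomb _ _ _ oO) // => [|jk]; last first.
    by apply: CkW; exact/Ck_derive/Ck_derive.
  by rewrite pair_big; apply: eq_bigr => -[].
have E2 : \sum_j \sum_k w.2 0 j * w.2 0 k * 'D_(q, 0) (pdbar j (pdbar k C)) p =
    \sum_j \sum_k w.2 0 j * w.2 0 k * \sum_a (\sum_f
     (\sum_i \sum_l w.1 0 i * w.1 0 l * pd i (pd l (pdbar f C)) p) *
     mixed_hessian_inv C p a f) * pd a (pdbar j (pdbar k C)) p.
  apply: eq_bigr => j _; apply: eq_bigr => k _; congr (_ * _).
  have Cjk : Ck 1 O (pdbar j (pdbar k C)) by apply: CkW; exact/Ck_derive/Ck_derive.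
  apply: etrans (esym (sum_pd q oO Op Cjk)) _.
  apply: eq_bigr => a _; rewrite -qE; congr (_ * _); apply: eq_bigr => f _.
  have Cf : Ck 2 O (pdbar f C) by apply: CkW; exact: Ck_derive.
  by rewrite (sum_pd2 w.1 oO Op Cf).
have E := contract_sums (w.1 0) (w.2 0) (fun i l f => pd i (pd l (pdbar f C)) p)
  (mixed_hessian_inv C p) (fun a j k => pd a (pdbar j (pdbar k C)) p).
have E3 := sum_pd2_pdbar2 w.1 w.2 oO Op CC.
transitivity (\sum_i \sum_l \sum_j \sum_k w.1 0 i * w.1 0 l * w.2 0 j * w.2 0 k *
    (\sum_a \sum_f pd i (pd l (pdbar f C)) p * mixed_hessian_inv C p a f *
        pd a (pdbar j (pdbar k C)) p) -
  \sum_i \sum_l \sum_j \sum_k w.1 0 i * w.1 0 l * w.2 0 j * w.2 0 k *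
    pd i (pd l (pdbar j (pdbar k C))) p); last first.
  exact: (congr2 (fun x y => x - y) (esym (etrans E1 (etrans E2 E))) E3).
rewrite -sumrB; apply: eq_bigr => i _.
rewrite -sumrB; apply: eq_bigr => l _.
rewrite -sumrB; apply: eq_bigr => j _.
rewrite -sumrB; apply: eq_bigr => k _.
by rewrite mulrBr.
Qed.

End CrossCurvature.

(** * Sign of the cross-curvature polynomials *)

Section ScalarInequalities.
Variable R : realFieldType.

(* Twice the cross-curvature of the cost u(<x, y>) at (xi, xib), where [ui] is
   the i-th derivative of u at s = <x, y>, a = <xi, y>, b = <x, xib>,
   m = <xi, xib>, X = <xi, xi> and Y = <xib, xib>. *)
Definition cross_value (K s u1 u2 u3 u4 a b m X Y : R) : R :=
  let k := (u3 * a ^+ 2 - K * X * (s * u2 + u1) - 2 * u2 ^+ 2 / u1 * a ^+ 2) /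
           (- K * s * u1 + K * (1 - s ^+ 2) * u2) in
  let qx := 2 * u2 / u1 * a ^+ 2 + k * (K * (1 - s ^+ 2)) in
  let qxi := 2 * u2 / u1 * a * m - k * (K * s * b) in
  u3 * b ^+ 2 * qx + u2 * (2 * b * qxi - K * Y * s * qx) - u1 * K * Y * qx
  - (u4 * a ^+ 2 * b ^+ 2
     + u3 * (4 * a * b * m - K * X * s * b ^+ 2 - K * Y * s * a ^+ 2)
     + u2 * (X * Y * s ^+ 2 + 2 * m ^+ 2 - 2 * K * X * b ^+ 2 - 2 * K * Y * a ^+ 2)
     + u1 * (X * Y * s)).

(** To be used with X = P + A and Y = Q + B. If E = 0, all four products P Q, P B, A Q, A B vanish,
    and they add up to (P + A)(Q + B). *)
Lemma split_form_gt0 (c1 c2 c3 P A Q B : R) :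
  0 < c1 -> 0 < c2 -> 0 < c3 -> 0 <= P -> 0 <= A -> 0 <= Q -> 0 <= B ->
  let E := c1 * (P * Q) + c2 * (P * B + A * Q) + c3 * (A * B) in
  0 <= E /\ (E = 0 -> P + A = 0 \/ Q + B = 0).
Proof.
move=> c1_gt0 c2_gt0 c3_gt0 P0 A0 Q0 B0 E.
have PQ : 0 <= P * Q by exact: mulr_ge0.
have PB : 0 <= P * B by exact: mulr_ge0.
have AQ : 0 <= A * Q by exact: mulr_ge0.
have AB : 0 <= A * B by exact: mulr_ge0.
have PBAQ : 0 <= P * B + A * Q by exact: addr_ge0.
have e1 : 0 <= c1 * (P * Q) by rewrite mulr_ge0 // ltW.
have e2 : 0 <= c2 * (P * B + A * Q) by rewrite mulr_ge0 // ltW.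
have e3 : 0 <= c3 * (A * B) by rewrite mulr_ge0 // ltW.
split; first by rewrite /E !addr_ge0.
move=> /eqP; rewrite /E paddr_eq0 ?addr_ge0 // paddr_eq0 //.
rewrite ![_ * _ == 0]mulf_eq0 (gt_eqF c1_gt0) (gt_eqF c2_gt0) (gt_eqF c3_gt0) /=.
rewrite paddr_eq0 // -!mulf_eq0 => /andP[/andP[/eqP h1 /andP[/eqP h2 /eqP h3]] /eqP h4].
have /eqP : (P + A) * (Q + B) = 0 by rewrite mulrDl !mulrDr h1 h2 h3 h4 !addr0.
by rewrite mulf_eq0 => /orP[]/eqP; [left|right].
Qed.

(** The coefficient of A B on the sphere, once X and Y are split and a^2, b^2 are divided by 1 -
    s^2. *)
Lemma sphere_coef_gt0 (g s : R) : 0 < g -> g <= 2^-1 -> -1 < s -> s <= 1 ->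
  0 < 1 + g * s - 2 * (1 - g) * g * (1 - s)
    - (1 - g) * g * (2 * g * (g * s + (1 - g)) - (1 - g)) * (1 - s) ^+ 2.
Proof.
move=> g0 g2 s1 s2; pose t := 1 + s; pose e := 1 - 2 * g.
have t0 : 0 < t by rewrite /t; lra.
have t2 : 0 <= 2 - t by rewrite /t; lra.
have e0 : 0 <= e by rewrite /e; lra.
set lhs := (X in 0 < X).
(* Expansion at s = -1, where the left-hand side vanishes to second order when
   g = 1/2. *)
have -> : lhs = ((1 - g) * e ^+ 2 * (4 * g + 1) + g * e * (2 - 3 * e ^+ 2) * t
    + (1 - g) * g * (8 * g ^+ 2 - 3 * g + 1) * t ^+ 2)
    + 2 * (1 - g) * g ^+ 3 * t ^+ 2 * (2 - t).
  by rewrite /lhs /e /t; field.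
(* The minimum of the right-hand side is 23/32, at g = 3/16. *)
have c : 7/10 <= 8 * g ^+ 2 - 3 * g + 1.
  by have := sqr_ge0 (g - 3/16); nra.
apply: ltr_wpDr.
  by rewrite !mulr_ge0 // ?sqr_ge0 ?exprn_ge0 //; lra.
have gt2 : 0 < g * t ^+ 2 by rewrite mulr_gt0 // exprn_gt0.
have le1 : (1 - g) * (7/10) * (g * t ^+ 2) <=
   (1 - g) * g * (8 * g ^+ 2 - 3 * g + 1) * t ^+ 2.
  have -> : (1 - g) * g * (8 * g ^+ 2 - 3 * g + 1) * t ^+ 2 =
    (1 - g) * (8 * g ^+ 2 - 3 * g + 1) * (g * t ^+ 2) by ring.
  by rewrite ler_pM2r // ler_pM2l //; lra.
have le2 : (1 - g) * e ^+ 2 <= (1 - g) * e ^+ 2 * (4 * g + 1).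
  by rewrite ler_peMr ?mulr_ge0 ?sqr_ge0 //; lra.
have gt3 : 0 < (1 - g) * (7/10) * (g * t ^+ 2) by rewrite mulr_gt0 //; lra.
have e2 : 0 <= (1 - g) * e ^+ 2 by rewrite mulr_ge0 ?sqr_ge0 //; lra.
(* Only the term linear in t can be negative, and then e^2 > 2/3 forces g to be small. *)
have [h|h] := lerP 0 (2 - 3 * e ^+ 2).
  have : 0 <= g * e * (2 - 3 * e ^+ 2) * t by rewrite !mulr_ge0 // ltW.
  lra.
have g10 : g <= 1 / 10 by rewrite /e in h *; nra.
have e1 : e <= 1 by rewrite /e; lra.
have le3 : - (g * e * t) <= g * e * (2 - 3 * e ^+ 2) * t.
  have -> : g * e * (2 - 3 * e ^+ 2) * t = - (g * e * t * (3 * e ^+ 2 - 2)) by ring.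
  rewrite lerN2 ler_piMr ?mulr_ge0 ?(ltW g0) ?(ltW t0) //.
  have : e ^+ 2 <= 1 by rewrite expr_le1.
  lra.
(* With 1 - g >= 9/10 and 9/10 * 7/10 = 63/100, the remaining terms dominate this quadratic form in
   e and t, which is positive by completing the square. *)
have : 0 < 9/10 * e ^+ 2 - g * e * t + 63/100 * (g * t ^+ 2).
  have -> : 9/10 * e ^+ 2 - g * e * t + 63/100 * (g * t ^+ 2) =
    9/10 * (e - 5/9 * g * t) ^+ 2 + (63/100 - 5/18 * g) * (g * t ^+ 2) by field.
  by apply: ltr_wpDl; [rewrite mulr_ge0 ?sqr_ge0 //; lra|rewrite mulr_gt0 //; lra].
have : 63/100 * (g * t ^+ 2) <= (1 - g) * (7/10) * (g * t ^+ 2).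
  by rewrite ler_pM2r //; lra.
have : 9/10 * e ^+ 2 <= (1 - g) * e ^+ 2 by rewrite ler_wpM2r ?sqr_ge0 //; lra.
lra.
Qed.

(** Here u1, ..., u4 have the ratios of the derivatives of -(1 + s)^g. The null condition eliminates
    [m], leaving a positive multiple of a polynomial [Q] in X, Y, a^2 and b^2. *)
Lemma sphere_cross_value (g s u1 a b m X Y : R) :
  let t := 1 + s in let d := 1 - g in
  let u2 := - d / t * u1 in let u3 := d * (1 + d) / t ^+ 2 * u1 in
  let u4 := - (d * (1 + d) * (2 + d)) / t ^+ 3 * u1 in
  0 < g -> g <= 2^-1 -> 0 < t -> s <= 1 -> u1 < 0 -> 0 <= X -> 0 <= Y ->
  a ^+ 2 <= X * (1 - s ^+ 2) -> b ^+ 2 <= Y * (1 - s ^+ 2) ->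
  u1 * m + u2 * (a * b) = 0 ->
  let E := cross_value 1 s u1 u2 u3 u4 a b m X Y in
  0 <= E /\ (E = 0 -> X = 0 \/ Y = 0).
Proof.
move=> t d u2 u3 u4 g0 g2 t0 s1 u1_lt0 X0 Y0 ha hb null E.
have t_neq0 : t != 0 by rewrite gt_eqF.
have u1_neq0 : u1 != 0 by rewrite lt_eqF.
(* D = 1 - g (1 - s), which exceeds 1 - 2 g >= 0 because s > -1. *)
pose D := g * s + d.
have D0 : 0 < D by rewrite /D /d; rewrite /t in t0; nra.
have D_neq0 : D != 0 by rewrite gt_eqF.
have mE : m = d * (a * b) / t.
  apply: (mulfI u1_neq0); move/eqP: null; rewrite addr_eq0 => /eqP ->.
  by rewrite /u2; field.
pose Q := (1 + g * s) * X * Y - d * g * (X * b ^+ 2 + a ^+ 2 * Y) / t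
   - d * g * (2 * g * D - d) * a ^+ 2 * b ^+ 2 / t ^+ 2.
have den : - 1 * s * u1 + 1 * (1 - s ^+ 2) * u2 = - (D * u1).
  by rewrite /u2 /D /d; rewrite /t in t_neq0 *; field.
have EE : E = - u1 / (t * D) * Q.
  rewrite /E /cross_value den mE /Q /u2 /u3 /u4.
  move: D_neq0 t_neq0; rewrite /D /d /t => D_neq0 t_neq0.
  by field; rewrite D_neq0 t_neq0 u1_neq0.
have c0 : 0 < - u1 / (t * D) by rewrite divr_gt0 ?oppr_gt0 // mulr_gt0.
suff [Q0 QX] : 0 <= Q /\ (Q = 0 -> X = 0 \/ Y = 0).
  split; first by rewrite EE mulr_ge0 // ltW.
  rewrite EE => /eqP; rewrite mulf_eq0 (gt_eqF c0) /= => /eqP; exact: QX.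
have gs : 0 < 1 + g * s by rewrite /t in t0; nra.
(* At s = 1 the vectors are orthogonal to x and y, and the normalization of
   [a ^+ 2] and [b ^+ 2] by [1 - s ^+ 2] below would divide by zero. *)
have [s_eq1|s_neq1] := eqVneq s 1.
  move: ha hb; rewrite s_eq1 expr1n subrr !mulr0 => ha hb.
  have a20 : a ^+ 2 = 0 by apply/eqP; rewrite eq_le ha sqr_ge0.
  have b20 : b ^+ 2 = 0 by apply/eqP; rewrite eq_le hb sqr_ge0.
  have -> : Q = (1 + g * s) * (X * Y) by rewrite /Q a20 b20; field.
  split; first by rewrite mulr_ge0 ?mulr_ge0 // ltW.
  by move=> /eqP; rewrite !mulf_eq0 (gt_eqF gs) /= => /orP[]/eqP; [left|right].
have s_lt1 : s < 1 by rewrite lt_neqAle s_neq1.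
have r0 : 0 < 1 - s ^+ 2 by rewrite /t in t0; nra.
pose A := a ^+ 2 / (1 - s ^+ 2); pose B := b ^+ 2 / (1 - s ^+ 2).
have A0 : 0 <= A by rewrite divr_ge0 ?sqr_ge0 // ltW.
have B0 : 0 <= B by rewrite divr_ge0 ?sqr_ge0 // ltW.
have P0 : 0 <= X - A by rewrite subr_ge0 ler_pdivrMr.
have Q0 : 0 <= Y - B by rewrite subr_ge0 ler_pdivrMr.
have c2 : 0 < 1 + g * s - d * g * (1 - s) by rewrite /d; rewrite /t in t0; nra.
have c3 : 0 < 1 + g * s - 2 * (1 - g) * g * (1 - s)
    - (1 - g) * g * (2 * g * (g * s + (1 - g)) - (1 - g)) * (1 - s) ^+ 2.
  by apply: sphere_coef_gt0 => //; rewrite /t in t0; lra.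
have [h1 h2] := split_form_gt0 gs c2 c3 P0 A0 Q0 B0.
rewrite !subrK in h2.
set E' := (X in 0 <= X) in h1; have -> : Q = E'; last by split.
rewrite /E' /Q.
have -> : a ^+ 2 = A * ((1 - s) * t).
  by rewrite /A /t; field; apply/eqP => h; move: r0; nra.
have -> : b ^+ 2 = B * ((1 - s) * t).
  by rewrite /B /t; field; apply/eqP => h; move: r0; nra.
by rewrite /D /d; field.
Qed.

(** The same elimination for the derivatives of -(-s)^be, whose successive ratios are d/s, (d - 1)/s
    and (d - 2)/s. *)
Lemma hyperboloid_cross_value (be s u1 a b m X Y : R) :
  let d := be - 1 in
  let u2 := d / s * u1 in let u3 := d * (d - 1) / s ^+ 2 * u1 in
  let u4 := d * (d - 1) * (d - 2) / s ^+ 3 * u1 in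
  1 <= be <= 2 -> s <= -1 -> 0 < u1 -> 0 <= X -> 0 <= Y ->
  a ^+ 2 <= X * (s ^+ 2 - 1) -> b ^+ 2 <= Y * (s ^+ 2 - 1) ->
  u1 * m + u2 * (a * b) = 0 ->
  let E := cross_value (-1) s u1 u2 u3 u4 a b m X Y in
  0 <= E /\ (E = 0 -> X = 0 \/ Y = 0).
Proof.
move=> d u2 u3 u4 /andP[be1 be2] s1 u1_gt0 X0 Y0 ha hb null E.
have s_neq0 : s != 0 by apply/eqP => h; move: s1; rewrite h; lra.
have u1_neq0 : u1 != 0 by rewrite gt_eqF.
pose D := (1 + d) * s ^+ 2 - d.
have d0 : 0 <= d by rewrite /d; lra.
have d1 : d <= 1 by rewrite /d; lra.
have s2 : 1 <= s ^+ 2 by nra.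
have D1 : 1 <= D by rewrite /D; nra.
have D0 : 0 < D by lra.
have D_neq0 : D != 0 by rewrite gt_eqF.
have mE : m = - d * (a * b) / s.
  apply: (mulfI u1_neq0); move/eqP: null; rewrite addr_eq0 => /eqP ->.
  by rewrite /u2; field.
pose S := - s.
have S1 : 1 <= S by rewrite /S; lra.
have S0 : 0 < S by lra.
have S_neq0 : S != 0 by rewrite gt_eqF.
have sE : s = - S by rewrite opprK.
pose Q := S * X * Y - d * (X * b ^+ 2 + a ^+ 2 * Y) / S
   + d * (2 * (1 + d) * D + d) * a ^+ 2 * b ^+ 2 / S ^+ 3.
have den : - (-1) * s * u1 + -1 * (1 - s ^+ 2) * u2 = D * u1 / s.
  by rewrite /u2 /D /d; field.
have EE : E = u1 * (1 + d) / D * Q.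
  rewrite /E /cross_value den mE /Q /u2 /u3 /u4 /S.
  move: D_neq0; rewrite /D /d => D_neq0.
  by field; rewrite D_neq0 s_neq0 u1_neq0.
have c0 : 0 < u1 * (1 + d) / D by rewrite divr_gt0 ?mulr_gt0 //; lra.
suff [Q0 QX] : 0 <= Q /\ (Q = 0 -> X = 0 \/ Y = 0).
  split; first by rewrite EE mulr_ge0 // ltW.
  rewrite EE => /eqP; rewrite mulf_eq0 (gt_eqF c0) /= => /eqP; exact: QX.
(* For S = 1 the bounds force a = b = 0; otherwise a^2 and b^2 can be divided by S^2 - 1. *)
have [s_eq1|s_neq1] := eqVneq S 1.
  move: ha hb; rewrite sE sqrrN s_eq1 expr1n subrr !mulr0 => ha hb.
  have a20 : a ^+ 2 = 0 by apply/eqP; rewrite eq_le ha sqr_ge0.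
  have b20 : b ^+ 2 = 0 by apply/eqP; rewrite eq_le hb sqr_ge0.
  have -> : Q = S * (X * Y) by rewrite /Q a20 b20; field.
  split; first by rewrite mulr_ge0 ?mulr_ge0 // ltW.
  by move=> /eqP; rewrite !mulf_eq0 (gt_eqF S0) /= => /orP[]/eqP; [left|right].
have S_gt1 : 1 < S by rewrite lt_neqAle eq_sym s_neq1.
rewrite sE sqrrN in ha hb.
pose v := S ^+ 2 - 1.
have v0 : 0 < v by rewrite /v; nra.
have v_neq0 : v != 0 by rewrite gt_eqF.
pose A := a ^+ 2 / v; pose B := b ^+ 2 / v.
have A0 : 0 <= A by rewrite divr_ge0 ?sqr_ge0 // ltW.
have B0 : 0 <= B by rewrite divr_ge0 ?sqr_ge0 // ltW.
have P0 : 0 <= X - A by rewrite subr_ge0 ler_pdivrMr.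
have Q0 : 0 <= Y - B by rewrite subr_ge0 ler_pdivrMr.
(* The bound be <= 2 enters as d <= 1: S^2 - d v >= S^2 - v = 1. *)
have c2 : 0 < (S ^+ 2 - d * v) / S by rewrite divr_gt0 // /v; nra.
(* The coefficient of A B, expanded in powers of v through S^2 = 1 + v, so that every term is
   visibly nonnegative. *)
have c3 : 0 < (1 + 2 * v * (1 - d) +
   v ^+ 2 * ((1 - d) ^+ 2 + 2 * d * (1 + d) * D)) / S ^+ 3.
  rewrite divr_gt0 ?exprn_gt0 // -addrA ltr_pwDl // addr_ge0 ?mulr_ge0 ?sqr_ge0 //; try lra.
  by rewrite addr_ge0 ?sqr_ge0 // !mulr_ge0 //; lra.
have [h1 h2] := split_form_gt0 S0 c2 c3 P0 A0 Q0 B0.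
rewrite !subrK in h2.
set E' := (X in 0 <= X) in h1; have -> : Q = E'; last by split.
rewrite /E' /Q.
have -> : a ^+ 2 = A * v by rewrite /A; field.
have -> : b ^+ 2 = B * v by rewrite /B; field.
by rewrite /D sE /v; field.
Qed.

End ScalarInequalities.

(** * Charts of the quadrics *)

Section WeightedDot.
Variables (R : realType) (m : nat) (K : R).
Implicit Types x y z : 'rV[R]_m.+1.

Definition weight (i : 'I_m.+1) : R := if i == ord0 then K else 1.

Definition wdot x y : R := \sum_i weight i * (x 0 i * y 0 i).

Lemma wdotC x y : wdot x y = wdot y x.
Proof. by apply: eq_bigr => i _; rewrite [x 0 i * _]mulrC. Qed.

Lemma wdotDl x y z : wdot (x + y) z = wdot x z + wdot y z.
Proof. by rewrite /wdot -big_split /=; apply: eq_bigr => i _; rewrite !mxE; ring. Qed.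

Lemma wdotZl a x y : wdot (a *: x) y = a * wdot x y.
Proof. by rewrite /wdot mulr_sumr; apply: eq_bigr => i _; rewrite !mxE; ring. Qed.

Lemma wdotDr x y z : wdot x (y + z) = wdot x y + wdot x z.
Proof. by rewrite wdotC wdotDl !(wdotC x). Qed.

Lemma wdotZr a x y : wdot x (a *: y) = a * wdot x y.
Proof. by rewrite wdotC wdotZl (wdotC x). Qed.

Lemma wdot0l y : wdot 0 y = 0.
Proof. by rewrite -(scale0r 0) wdotZl mul0r. Qed.

Lemma wdot0r y : wdot y 0 = 0.
Proof. by rewrite wdotC wdot0l. Qed.

Lemma wdotNl x y : wdot (- x) y = - wdot x y.
Proof. by rewrite -scaleN1r wdotZl mulN1r. Qed.

Lemma wdot_recl x y : wdot x y = K * (x 0 ord0 * y 0 ord0) +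
  \sum_(i < m) x 0 (lift ord0 i) * y 0 (lift ord0 i).
Proof.
rewrite /wdot big_ord_recl /weight eqxx; congr (_ + _); apply: eq_bigr => i _.
by rewrite mul1r.
Qed.

(** Turns the orthogonal complement of [y] into a matrix kernel, for the rank count in
    [dirD_onto]. *)
Lemma wdot_mulmx x y : wdot x y = (x *m \col_i (weight i * y 0 i)) 0 0.
Proof. by rewrite mxE; apply: eq_bigr => i _; rewrite !mxE; ring. Qed.

Lemma is_derive_row (V : normedModType R) k (A : V -> 'rV[R]_k) t v dA i :
  is_derive t v A dA -> is_derive t v (fun s => A s 0 i) (dA 0 i).
Proof.
move=> [h1 <-]; rewrite (derive_mx h1) mxE; apply: derivableP.
exact: ((derivable_mxP A t v).1 h1 0 i).
Qed.

Lemma is_derive_wdot (V : normedModType R) (A B : V -> 'rV[R]_m.+1) t v dA dB :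
  is_derive t v A dA -> is_derive t v B dB ->
  is_derive t v (fun s => wdot (A s) (B s)) (wdot dA (B t) + wdot (A t) dB).
Proof.
move=> hA hB.
have h i : is_derive t v (fun s => weight i * (A s 0 i * B s 0 i))
    (weight i * (dA 0 i * B t 0 i) + weight i * (A t 0 i * dB 0 i)).
  apply: (is_derive_eq (is_derive_mulf (is_derive_cst (weight i) t v)
    (is_derive_mulf (is_derive_row i hA) (is_derive_row i hB)))).
  by rewrite mul0r addr0 mulrDr addrC.
have := is_derive_sumf (index_enum 'I_m.+1) (P := xpredT) (fun i _ => h i).
by rewrite big_split.
Qed.

End WeightedDot.

Lemma dot_wdot (R : realType) n (x y : 'rV[R]_n.+1) : dot x y = wdot 1 x y.
Proof.
by apply: eq_bigr => i _; rewrite /weight; case: ifP; rewrite mul1r.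
Qed.

Lemma lorentz_wdot (R : realType) n (x y : 'rV[R]_n.+1) : lorentz x y = wdot (-1) x y.
Proof. by rewrite wdot_recl mulN1r. Qed.

Lemma smooth_derive (R : realType) (V W : normedModType R) (U : set V)
    (f : V -> W) v :
  smooth U f -> smooth U ('D_v f).
Proof. by move=> Cf k; exact: Ck_derive (Cf k.+1). Qed.

Lemma smooth_is_derive (R : realType) (V W : normedModType R) (U : set V)
    (f : V -> W) x v :
  smooth U f -> U x -> is_derive x v f ('D_v f x).
Proof. by move=> Cf Ux; apply: derivableP; exact: Ck_derivable (Cf 1) Ux. Qed.

(** * Derivatives of the cost in local coordinates *)

Section CoordinateDerivatives.
Variables (R : realType) (n m : nat) (K : R).
Implicit Types (p : 'rV[R]_n * 'rV[R]_n) (v w e d : 'rV[R]_n).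
Implicit Types (A B : 'rV[R]_n -> 'rV[R]_m.+1).

(* Fixes the type of ['D_v A], so that iterated derivatives are syntactically
   equal whenever they are convertible. *)
Definition dirD v A : 'rV[R]_n -> 'rV[R]_m.+1 := 'D_v A.

Lemma smooth_dirD (U : set 'rV[R]_n) v A : smooth U A -> smooth U (dirD v A).
Proof. exact: smooth_derive. Qed.

Definition pairing A B p : R := wdot K (A p.1) (B p.2).

(** Along (v, 0) the factor [B] moves in the zero direction and contributes nothing. *)
Lemma is_derive_pairing_fst (U : set 'rV[R]_n) A B p v :
  smooth U A -> U p.1 ->
  is_derive p (v, 0) (pairing A B) (pairing (dirD v A) B p).
Proof.
move=> CA Up; rewrite -[pairing (dirD v A) B p]addr0 -(wdot0r K (A p.1)).
apply: is_derive_wdot.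
  by apply: (@is_derive_comp_linear _ _ _ _ fst A) => //; exact: smooth_is_derive Up.
by apply: (@is_derive_comp_linear _ _ _ _ snd B) => //; exact: is_derive0.
Qed.

Lemma is_derive_pairing_snd (U : set 'rV[R]_n) A B p v :
  smooth U B -> U p.2 ->
  is_derive p (0, v) (pairing A B) (pairing A (dirD v B) p).
Proof.
move=> CB Up; rewrite -[pairing A (dirD v B) p]add0r -(wdot0l K (B p.2)).
apply: is_derive_wdot.
  by apply: (@is_derive_comp_linear _ _ _ _ fst A) => //; exact: is_derive0.
by apply: (@is_derive_comp_linear _ _ _ _ snd B) => //; exact: smooth_is_derive Up.
Qed.

Variables (U Ub : set 'rV[R]_n) (O : set ('rV[R]_n * 'rV[R]_n)).
Variables (phi phib : 'rV[R]_n -> 'rV[R]_m.+1) (u : nat -> R -> R).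
Hypothesis (Cphi : smooth U phi) (Cphib : smooth Ub phib).
Hypothesis oO : open O.
Hypothesis (OU : forall p, O p -> U p.1) (OUb : forall p, O p -> Ub p.2).
Hypothesis du : forall k p, O p ->
  is_derive (pairing phi phib p) 1 (u k) (u k.+1 (pairing phi phib p)).

Local Notation F := pairing.
Local Notation S := (pairing phi phib).
Local Notation cost := (fun p => u 0%N (S p)).

Let der_u_fst k p v : O p ->
  is_derive p (v, 0) (fun p => u k (S p)) (u k.+1 (S p) * F (dirD v phi) phib p).
Proof.
move=> Op; apply: is_derive_compf; last exact: du.
exact: is_derive_pairing_fst (OU Op).
Qed.

Let der_u_snd k p v : O p ->
  is_derive p (0, v) (fun p => u k (S p)) (u k.+1 (S p) * F phi (dirD v phib) p).
Proof.
move=> Op; apply: is_derive_compf; last exact: du.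
exact: is_derive_pairing_snd (OUb Op).
Qed.

Ltac smoothness := repeat apply: smooth_dirD; assumption.
(** Differentiates sums and products recursively, down to pairings and the functions [u k (S p)]. *)
Ltac der Op := cbv beta; lazymatch goal with
  | |- is_derive _ (_, 0) (pairing _ _) _ =>
    apply: (is_derive_pairing_fst _ _ _ (OU Op)); smoothness
  | |- is_derive _ (0, _) (pairing _ _) _ =>
    apply: (is_derive_pairing_snd _ _ _ (OUb Op)); smoothness
  | |- is_derive _ (_, 0) (fun y => u _ _) _ => apply: (der_u_fst _ _ Op)
  | |- is_derive _ (0, _) (fun y => u _ _) _ => apply: (der_u_snd _ _ Op)
  | |- is_derive _ _ (fun y => pairing ?A ?B y) _ =>
    change (fun y => pairing A B y) with (pairing A B); der Op
  | |- is_derive _ _ (fun y => @?f y * @?g y) _ => apply: is_derive_mulf; der Op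
  | |- is_derive _ _ (fun y => @?f y + @?g y) _ => apply: is_derive_addf; der Op
  end.

Lemma derive_cost_snd e :
  {in O, 'D_(0, e) cost =1 fun p => u 1 (S p) * F phi (dirD e phib) p}.
Proof. by move=> p; rewrite inE => Op; apply: derive_val; exact: der_u_snd. Qed.

Lemma derive_cost_fst v :
  {in O, 'D_(v, 0) cost =1 fun p => u 1 (S p) * F (dirD v phi) phib p}.
Proof. by move=> p; rewrite inE => Op; apply: derive_val; exact: der_u_fst. Qed.

(** Differentiates the formula [E], valid on all of the open set [O]; the pairings and profile
    values are then abstracted into variables for [ring]. *)
Ltac der_from E :=
  let p := fresh "p" in let Op := fresh "Op" in
  move=> p; rewrite inE => Op; apply: derive_val;
  apply: (open_eq_is_derive oO Op E); apply: is_derive_eq; [der Op | cbv beta];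
  repeat match goal with |- context [u ?k (pairing ?A ?B ?q)] =>
    generalize (u k (pairing A B q)); intro end;
  repeat match goal with |- context [pairing ?A ?B ?q] =>
    generalize (pairing A B q); intro end;
  ring.

Lemma derive_cost_fst_snd v e :
  {in O, 'D_(v, 0) ('D_(0, e) cost) =1 fun p =>
    u 2 (S p) * F (dirD v phi) phib p * F phi (dirD e phib) p +
    u 1 (S p) * F (dirD v phi) (dirD e phib) p}.
Proof. der_from (derive_cost_snd e). Qed.

Lemma derive_cost_snd_fst e v :
  {in O, 'D_(0, e) ('D_(v, 0) cost) =1 fun p =>
    u 2 (S p) * F (dirD v phi) phib p * F phi (dirD e phib) p +
    u 1 (S p) * F (dirD v phi) (dirD e phib) p}.
Proof. der_from (derive_cost_fst v). Qed.

Lemma derive_cost_snd2 e :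
  {in O, 'D_(0, e) ('D_(0, e) cost) =1 fun p =>
    u 2 (S p) * (F phi (dirD e phib) p * F phi (dirD e phib) p) +
    u 1 (S p) * F phi (dirD e (dirD e phib)) p}.
Proof. der_from (derive_cost_snd e). Qed.

Lemma derive_cost_fst2_snd v e :
  {in O, 'D_(v, 0) ('D_(v, 0) ('D_(0, e) cost)) =1 fun p =>
    u 3 (S p) * F (dirD v phi) phib p ^+ 2 * F phi (dirD e phib) p +
    u 2 (S p) * (F (dirD v (dirD v phi)) phib p * F phi (dirD e phib) p +
      2 * F (dirD v phi) phib p * F (dirD v phi) (dirD e phib) p) +
    u 1 (S p) * F (dirD v (dirD v phi)) (dirD e phib) p}.
Proof. der_from (derive_cost_fst_snd v e). Qed.

Lemma derive_cost_fst_snd2 v e :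
  {in O, 'D_(v, 0) ('D_(0, e) ('D_(0, e) cost)) =1 fun p =>
    u 3 (S p) * (F (dirD v phi) phib p *
      (F phi (dirD e phib) p * F phi (dirD e phib) p)) +
    u 2 (S p) * (2 * (F (dirD v phi) (dirD e phib) p * F phi (dirD e phib) p) +
      F (dirD v phi) phib p * F phi (dirD e (dirD e phib)) p) +
    u 1 (S p) * F (dirD v phi) (dirD e (dirD e phib)) p}.
Proof. der_from (derive_cost_snd2 e). Qed.

Lemma derive_cost_fst2_snd2 v e :
  {in O, 'D_(v, 0) ('D_(v, 0) ('D_(0, e) ('D_(0, e) cost))) =1 fun p =>
    u 4 (S p) * F (dirD v phi) phib p ^+ 2 * F phi (dirD e phib) p ^+ 2 +
    u 3 (S p) * (F (dirD v (dirD v phi)) phib p * F phi (dirD e phib) p ^+ 2 +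
      F (dirD v phi) phib p ^+ 2 * F phi (dirD e (dirD e phib)) p +
      4 * F (dirD v phi) phib p * F phi (dirD e phib) p * F (dirD v phi) (dirD e phib) p) +
    u 2 (S p) * (2 * F (dirD v phi) (dirD e phib) p ^+ 2 +
      2 * F (dirD v (dirD v phi)) (dirD e phib) p * F phi (dirD e phib) p +
      2 * F (dirD v phi) phib p * F (dirD v phi) (dirD e (dirD e phib)) p +
      F (dirD v (dirD v phi)) phib p * F phi (dirD e (dirD e phib)) p) +
    u 1 (S p) * F (dirD v (dirD v phi)) (dirD e (dirD e phib)) p}.
Proof. der_from (derive_cost_fst_snd2 v e). Qed.

End CoordinateDerivatives.

(** * Tangent spaces in a chart *)

Section LocalParam.
Variables (R : realType) (n : nat) (K : R) (M : set 'rV[R]_n.+1).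
Variables (U : set 'rV[R]_n) (phi : 'rV[R]_n -> 'rV[R]_n.+1).
Hypothesis lphi : local_param M U phi.
Implicit Types (y v w : 'rV[R]_n).

Lemma local_param_open : open U. Proof. by case: lphi. Qed.
Lemma local_param_smooth : smooth U phi. Proof. by case: lphi. Qed.

(** The topological clause of [local_param] for V = U writes the image as a subset of [M]. *)
Lemma local_param_mem y : U y -> M (phi y).
Proof.
move=> Uy; have [oU _ _ _ /(_ U oU (@subset_refl _ U))[W _ E]] := lphi.
have : (phi @` U) (phi y) by exists y.
by rewrite E => -[].
Qed.

Lemma dirD_eq0 y v : U y -> dirD v phi y = 0 -> v = 0.
Proof.
by move=> Uy v0; have [_ _ /(_ _ Uy) inj _ _] := lphi; apply: inj; rewrite derive0.
Qed.

(** Linearity in the direction was proved for real-valued functions, hence the passage to the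
    coordinates of [phi]. *)
Lemma dirD_mulmx y v : U y ->
  dirD v phi y = v *m \matrix_(i, j) dirD (delta_mx 0 i) phi y 0 j.
Proof.
move=> Uy; have Cphi := local_param_smooth.
have D w j : dirD w phi y 0 j = 'D_w (fun z => phi z 0 j) y.
  by rewrite /dirD (derive_mx (Ck_derivable (Cphi 1) Uy)) mxE.
apply/rowP => j; rewrite D mxE.
have C1 := (Ck_rowP 1 phi local_param_open).1 (Cphi 1) j.
rewrite {1}[v]row_sum_delta (derive_sumdir _ _ _ local_param_open Uy C1).
by apply: eq_bigr => i _; rewrite mxE D.
Qed.

Hypothesis MK : forall x, M x -> wdot K x x = K.

(** Derivative of the constant function <phi, phi> = K. *)
Lemma wdot_dirD y v : U y -> wdot K (phi y) (dirD v phi y) = 0.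
Proof.
move=> Uy; have hphi := smooth_is_derive v local_param_smooth Uy.
have h := is_derive_wdot K hphi hphi.
have : 'D_v (fun y => wdot K (phi y) (phi y)) y = 0.
  rewrite (@open_eq_derive _ _ _ U _ (fun=> K)) ?derive_cst //.
    exact: local_param_open.
  by move=> z; rewrite inE => Uz; rewrite MK //; exact: local_param_mem.
rewrite (derive_val (is_derive := h)) (wdotC _ ('D_v phi y)) => /eqP.
by rewrite -mulr2n mulrn_eq0 /= => /eqP.
Qed.

(** Derivative of the tangency relation <phi, D_v phi> = 0. *)
Lemma wdot_dirD2 y v : U y -> wdot K (phi y) (dirD v (dirD v phi) y) =
  - wdot K (dirD v phi y) (dirD v phi y).
Proof.
move=> Uy; have Cphi := local_param_smooth.
have hphi := smooth_is_derive v Cphi Uy.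
have hdphi := smooth_is_derive v (smooth_dirD v Cphi) Uy.
have h := is_derive_wdot K hphi hdphi.
have : 'D_v (fun y => wdot K (phi y) (dirD v phi y)) y = 0.
  rewrite (@open_eq_derive _ _ _ U _ (fun=> 0)) ?derive_cst //.
    exact: local_param_open.
  by move=> z; rewrite inE => Uz; rewrite wdot_dirD.
by rewrite (derive_val (is_derive := h)) => /eqP; rewrite addrC addr_eq0 => /eqP.
Qed.

Hypothesis K_neq0 : K != 0.

(** Dimension count: the row space of the Jacobian [J] has rank n by injectivity and lies in the
    kernel of the column [c], which is nonzero since <phi y, phi y> = K, so that the kernel also has
    rank n. *)
Lemma dirD_onto y z : U y -> wdot K (phi y) z = 0 -> exists q, dirD q phi y = z.
Proof.
move=> Uy xz; pose J := \matrix_(i < n, j < n.+1) dirD (delta_mx 0 i) phi y 0 j.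
pose c : 'cV[R]_n.+1 := \col_i (weight K i * phi y 0 i).
have JE v : dirD v phi y = v *m J by exact: dirD_mulmx.
have J_free : row_free J.
  by apply: inj_row_free => v; rewrite -JE; exact: dirD_eq0.
have Jc : J *m c = 0.
  apply/row_matrixP => i; rewrite row_mul row0 rowE -JE.
  apply/rowP => j; rewrite ord1 -wdot_mulmx wdotC wdot_dirD // mxE.
  by [].
have c_neq0 : c != 0.
  apply/eqP => c0; move: K_neq0; rewrite -(MK (local_param_mem Uy)) wdot_mulmx.
  by rewrite -/c c0 mulmx0 mxE eqxx.
have rc : \rank c = 1%N.
  by apply/eqP; rewrite eqn_leq rank_leq_col lt0n mxrank_eq0.
have JK : (J <= kermx c)%MS by apply/sub_kermxP.
have /eqmxP KJ : (J == kermx c)%MS.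
  by rewrite -(mxrank_leqif_eq JK) mxrank_ker rc subn1 /= -/(row_free J) J_free.
have : (z <= J)%MS.
  rewrite KJ; apply/sub_kermxP/rowP => j; rewrite ord1 -wdot_mulmx wdotC xz mxE.
  by [].
by move=> /submxP[q ->]; exists q; rewrite JE.
Qed.

End LocalParam.

Lemma Ck_coord (R : realType) m k (U : set 'rV[R]_m) i : Ck k U (fun y => y 0 i).
Proof.
have d (y v : 'rV[R]_m) := is_derive_row i (is_derive_id y v).
have c (y : 'rV[R]_m) : {for y, continuous (fun z : 'rV[R]_m => z 0 i)}.
  exact: coord_continuous.
case: k => [|k]; first by split=> // y _; exact: c.
split=> [y _|v]; first exact: c.
split=> [y _|]; first exact: (ex_derive (is_derive := d y v)).
rewrite (_ : 'D_v _ = fun=> v 0 i); first exact: Ck_cst.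
by apply/funext => y; apply: derive_val.
Qed.

Lemma open_preimage_continuous (R : realType) (V W : normedModType R)
    (A : set V) (B : set W) (f : V -> W) :
  open A -> open B -> (forall x, A x -> {for x, continuous f}) ->
  open (A `&` f @^-1` B).
Proof.
move=> oA oB cf; rewrite openE => x [Ax Bx]; apply: filterI.
  exact: open_nbhs_nbhs.
exact: cf Ax _ (open_nbhs_nbhs (conj oB Bx)).
Qed.

Lemma open_gt0_continuous (R : realType) (V : normedModType R) (A : set V)
    (f : V -> R) :
  open A -> (forall x, A x -> {for x, continuous f}) ->
  open (A `&` [set x | 0 < f x]).
Proof.
by move=> oA cf; exact: (open_preimage_continuous oA (@open_gt R 0) cf).
Qed.

Lemma Ck_affine (R : realType) (V : normedModType R) k (U : set V) (f : V -> R)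
    a c :
  open U ->
  Ck k U f -> Ck k U (fun y => a + c * f y).
Proof.
move=> oU Cf; apply: Ck_add => //; first exact: Ck_cst.
by apply: Ck_mul => //; exact: Ck_cst.
Qed.

(** * Stereographic projection *)

Section Stereographic.
Variables (R : realType) (n : nat) (K : R) (M : set 'rV[R]_n.+1).
Hypothesis K2 : K ^+ 2 = 1.
Hypothesis MK : forall x, M x -> wdot K x x = K.
Implicit Types (e : R) (y : 'rV[R]_n) (x : 'rV[R]_n.+1).

Definition normsq y : R := \sum_i y 0 i * y 0 i.

Lemma normsq_ge0 y : 0 <= normsq y.
Proof. by apply: sumr_ge0 => i _; rewrite -expr2 sqr_ge0. Qed.

(* Stereographic projection from the point with x_0 = -e. *)
Definition chart_dom : set 'rV[R]_n := [set y | 0 < 1 + K * normsq y].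

(** Division is written as the power -1, here and in [chart_inv], so that [Ck_powR] gives
    smoothness. *)
Definition chart e y : 'rV[R]_n.+1 := \row_i
  ((if unlift ord0 i is Some j then 2 * y 0 j else e * (1 + - K * normsq y)) *
   (1 + K * normsq y) `^ (-1)).

Definition chart_inv e x : 'rV[R]_n :=
  \row_j (x 0 (lift ord0 j) * (1 + e * x 0 ord0) `^ (-1)).

Lemma chart0 e y : chart_dom y ->
  chart e y 0 ord0 = e * (1 - K * normsq y) / (1 + K * normsq y).
Proof. by move=> Uy; rewrite mxE unlift_none mulNr powR_inv1 ?ltW. Qed.

Lemma chart_lift e y j : chart_dom y ->
  chart e y 0 (lift ord0 j) = 2 * y 0 j / (1 + K * normsq y).
Proof. by move=> Uy; rewrite mxE liftK powR_inv1 ?ltW. Qed.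

Lemma Ck_normsq k (U : set 'rV[R]_n) : open U -> Ck k U normsq.
Proof. by move=> oU; apply: Ck_sum => // i; apply: Ck_mul => //; exact: Ck_coord. Qed.

Lemma open_chart_dom : open chart_dom.
Proof.
rewrite -(setTI chart_dom); apply: open_gt0_continuous => [|y _]; first exact: openT.
have oT : open [set: 'rV[R]_n] by exact: openT.
exact: Ck_continuous (Ck_affine 1 K oT (Ck_normsq 0 oT)) I.
Qed.

Lemma smooth_chart e : smooth chart_dom (chart e).
Proof.
move=> k; apply/Ck_rowP => [|i]; first exact: open_chart_dom.
have oU : open chart_dom by exact: open_chart_dom.
 under eq_fun do rewrite mxE.
apply: Ck_mul => //; last by apply: Ck_powR => //; exact/Ck_affine/Ck_normsq.
case: unliftP => [j _|_]; apply: Ck_mul => //; try exact: Ck_cst.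
  exact: Ck_coord.
exact/Ck_affine/Ck_normsq.
Qed.

Definition chart_codom e : set 'rV[R]_n.+1 := [set x | 0 < 1 + e * x 0 ord0].

Lemma open_chart_codom e : open (chart_codom e).
Proof.
rewrite -(setTI (chart_codom e)); apply: open_gt0_continuous => [|y _]; first exact: openT.
have oT : open [set: 'rV[R]_n.+1] by exact: openT.
exact: Ck_continuous (Ck_affine 1 e oT (Ck_coord 0 setT ord0)) I.
Qed.

Lemma chart_inv_continuous e x : chart_codom e x -> {for x, continuous (chart_inv e)}.
Proof.
have oW : open (chart_codom e) by exact: open_chart_codom.
move=> Wx; apply: (@Ck_continuous _ _ _ 0 (chart_codom e)) => //.
apply/Ck_rowP => // i; under eq_fun do rewrite mxE.
apply: Ck_mul => //; first exact: Ck_coord.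
by apply: Ck_powR => //; apply: Ck_affine => //; exact: Ck_coord.
Qed.

Lemma chart_codomE e y : e ^+ 2 = 1 -> chart_dom y ->
  1 + e * chart e y 0 ord0 = 2 / (1 + K * normsq y).
Proof.
move=> e2 Uy; rewrite chart0 // !mulrA -expr2 e2 mul1r.
by field; rewrite gt_eqF.
Qed.

Lemma chartK e y : e ^+ 2 = 1 -> chart_dom y -> chart_inv e (chart e y) = y.
Proof.
move=> e2 Uy; apply/rowP => j; rewrite mxE chart_codomE // chart_lift //.
rewrite powR_inv1 ?divr_ge0 ?ltW //.
by field; rewrite gt_eqF.
Qed.

(** Multiplying <x, x> = K by K turns the sum of the other squares, times K, into 1 - x_0^2 = 1 - (d
    - 1)^2. *)
Lemma normsq_chart_inv e x : e ^+ 2 = 1 -> M x -> chart_codom e x ->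
  1 + K * normsq (chart_inv e x) = 2 / (1 + e * x 0 ord0).
Proof.
move=> e2 Mx Wx; set d := 1 + e * x 0 ord0.
have d0 : 0 < d by [].
have d_neq0 : d != 0 by rewrite gt_eqF.
have -> : normsq (chart_inv e x) =
    (\sum_j x 0 (lift ord0 j) * x 0 (lift ord0 j)) / d ^+ 2.
  rewrite /normsq mulr_suml; apply: eq_bigr => j _.
  by rewrite mxE powR_inv1 ?ltW // -/d; field.
have := MK Mx; rewrite wdot_recl => /(congr1 (fun z => K * z)).
rewrite mulrDr mulrA -expr2 K2 mul1r => /eqP; rewrite addrC eq_sym -subr_eq => /eqP.
move=> E; rewrite mulrA -E.
have -> : x 0 ord0 * x 0 ord0 = (d - 1) ^+ 2.
  by rewrite /d [1 + _]addrC addrK exprMn e2 mul1r expr2.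
by field.
Qed.

Lemma chart_dom_inv e x : e ^+ 2 = 1 -> M x -> chart_codom e x ->
  chart_dom (chart_inv e x).
Proof. by move=> e2 Mx Wx; rewrite /chart_dom /= normsq_chart_inv // divr_gt0. Qed.

Lemma chart_invK e x : e ^+ 2 = 1 -> M x -> chart_codom e x ->
  chart e (chart_inv e x) = x.
Proof.
move=> e2 Mx Wx; have UE := normsq_chart_inv e2 Mx Wx.
have Ux := chart_dom_inv e2 Mx Wx; set d := 1 + e * x 0 ord0 in UE.
have d0 : 0 < d by [].
have d_neq0 : d != 0 by rewrite gt_eqF.
apply/rowP => i; case: (unliftP ord0 i) => [j ->|->].
  rewrite chart_lift // UE mxE powR_inv1 ?ltW // -/d.
  by field.
rewrite chart0 // (_ : 1 - _ = 2 - (1 + K * normsq (chart_inv e x))); last by ring.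
rewrite UE; transitivity (e * (d - 1)); first by field.
by rewrite /d [1 + _]addrC addrK mulrA -expr2 e2 mul1r.
Qed.

(** Differentiating chart_j = y_j (1 + e chart_0) expresses v_j through the derivative of the chart,
    as 1 + e chart_0 is nonzero. *)
Lemma chart_immersion e y : e ^+ 2 = 1 -> chart_dom y ->
  injective (fun v => 'D_v (chart e) y).
Proof.
move=> e2 Uy.
have c_neq0 : 1 + e * chart e y 0 ord0 != 0.
  by rewrite (chart_codomE e2 Uy) gt_eqF // divr_gt0.
have dchart v' := smooth_is_derive v' (smooth_chart e) Uy.
have dcodom v' : is_derive y v' (fun z => 1 + e * chart e z 0 ord0)
    (0 + (e * 'D_v' (chart e) y 0 ord0 + 0 * chart e y 0 ord0)).
  exact: is_derive_addf (is_derive_cst (1 : R) y v') (is_derive_mulf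
    (is_derive_cst e y v') (is_derive_row ord0 (dchart v'))).
have key v' d j : d = 'D_v' (chart e) y -> d 0 (lift ord0 j) =
    y 0 j * (e * d 0 ord0) + v' 0 j * (1 + e * chart e y 0 ord0).
  move=> ->.
  have h := is_derive_mulf (is_derive_row j (is_derive_id y v')) (dcodom v').
  apply: etrans (esym (derive_val
    (is_derive := is_derive_row (lift ord0 j) (dchart v')))) _.
  transitivity ('D_v' (fun z : 'rV_n => z 0 j * (1 + e * chart e z 0 ord0)) y).
    apply: (open_eq_derive _ _ Uy) => [|z]; first exact: open_chart_dom.
    rewrite inE => Uz; rewrite (chart_codomE e2 Uz) (chart_lift e j Uz).
    by field; rewrite gt_eqF.
  by apply: etrans (derive_val (is_derive := h)) _; rewrite add0r mul0r addr0.
move=> v w /= vw; apply/rowP => j.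
have Ev := key v _ j (esym vw).
have Ew := key w ('D_w (chart e) y) j erefl.
move: Ev Ew.
by generalize ('D_w (chart e) y) => d -> /addrI /mulIf; apply.
Qed.

Lemma local_param_chart e : e ^+ 2 = 1 ->
  (forall y, chart_dom y -> M (chart e y)) -> local_param M chart_dom (chart e).
Proof.
move=> e2 Mchart; split.
- exact: open_chart_dom.
- exact: smooth_chart.
- by move=> y; exact: chart_immersion.
- move=> y z; rewrite !inE => Uy Uz yz.
  by rewrite -(chartK e2 Uy) yz chartK.
(* The image of [V] is cut out by the continuous inverse on the open set [chart_codom e]. *)
- move=> V oV VU; exists (chart_codom e `&` chart_inv e @^-1` V).
    apply: open_preimage_continuous => //; first exact: open_chart_codom.
    exact: chart_inv_continuous.
  apply/seteqP; split=> [_ [y Vy <-]|x [Mx [Wx Vx]]].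
    have Uy := VU _ Vy; split; first exact: Mchart.
    split; last by rewrite /= chartK.
    by rewrite /chart_codom /= chart_codomE // divr_gt0.
  by exists (chart_inv e x) => //; exact: chart_invK.
Qed.

Lemma wdot_chart e y : e ^+ 2 = 1 -> chart_dom y ->
  wdot K (chart e y) (chart e y) = K.
Proof.
move=> e2 Uy; rewrite wdot_recl chart0 //.
under eq_bigr do rewrite chart_lift //.
have Uy0 : 1 + K * normsq y != 0 by rewrite gt_eqF.
have -> : \sum_(i < n) 2 * y 0 i / (1 + K * normsq y) *
    (2 * y 0 i / (1 + K * normsq y)) = 4 * normsq y / (1 + K * normsq y) ^+ 2.
  rewrite [X in 4 * X]/normsq mulr_sumr mulr_suml; apply: eq_bigr => i _.
  by field.
set q := normsq y in Uy0 *.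
transitivity ((K * e ^+ 2 * (1 - K * q) ^+ 2 + 4 * q) / (1 + K * q) ^+ 2).
  by field.
rewrite e2 (_ : _ + 4 * q = K * (1 + K * q) ^+ 2 + 4 * q * (1 - K ^+ 2)); last by ring.
by rewrite K2 subrr mulr0 addr0 mulfK // expf_neq0.
Qed.

Lemma stereographic_submanifold :
  (forall x, M x -> exists2 e, e ^+ 2 = 1 & chart_codom e x /\
     forall y, chart_dom y -> M (chart e y)) ->
  submanifold n M.
Proof.
move=> cover x Mx; have [e e2 [Wx Mchart]] := cover x Mx.
exists chart_dom, (chart e); split; first exact: local_param_chart.
by exists (chart_inv e x); [exact: chart_dom_inv|exact: chart_invK].
Qed.

End Stereographic.

(** * Tangent vectors at two points of a quadric *)

Section TangentAlgebra.
Variables (R : realType) (n : nat) (K : R) (M : set 'rV[R]_n.+1).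
Hypothesis K2 : K ^+ 2 = 1.
Hypothesis MK : forall x, M x -> wdot K x x = K.
Hypothesis Mpos : forall x v, M x -> wdot K x v = 0 ->
  0 <= wdot K v v /\ (wdot K v v = 0 -> v = 0).
Implicit Types x y v z : 'rV[R]_n.+1.
Local Notation "x ⋅ y" := (wdot K x y) (at level 40).

(** The form is positive on tangent vectors only, so the usual test vector <v, v> z - <v, z> v is
    used because it is again tangent at [x]. *)
Lemma tangent_CauchySchwarz x v z : M x -> x ⋅ v = 0 -> x ⋅ z = 0 ->
  (v ⋅ z) ^+ 2 <= (v ⋅ v) * (z ⋅ z).
Proof.
move=> Mx xv xz; have [vv_ge0 vv0] := Mpos Mx xv.
have [vv_eq0|vv_neq0] := eqVneq (v ⋅ v) 0.
  by rewrite (vv0 vv_eq0) !wdot0l expr0n mul0r.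
have vv_gt0 : 0 < v ⋅ v by rewrite lt_neqAle eq_sym vv_neq0.
pose y := (v ⋅ v) *: z + (- (v ⋅ z)) *: v.
have [yy _] : 0 <= y ⋅ y /\ (y ⋅ y = 0 -> y = 0).
  by apply: (Mpos Mx); rewrite wdotDr !wdotZr xv xz !mulr0 addr0.
have yyE : y ⋅ y = (v ⋅ v) * ((v ⋅ v) * (z ⋅ z) - (v ⋅ z) ^+ 2).
  by rewrite wdotDl !wdotZl !wdotDr !wdotZr (wdotC K z v); ring.
by move: yy; rewrite yyE pmulr_rge0 // subr_ge0.
Qed.

(** Orthogonal projection to the tangent space at [x]: as K^2 = 1, the factor K stands for 1/<x,
    x>. *)
Definition tproj x y : 'rV[R]_n.+1 := y + (- (K * (x ⋅ y))) *: x.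

Lemma wdot_tproj x y : M x -> x ⋅ tproj x y = 0.
Proof.
move=> Mx; rewrite wdotDr wdotZr MK // mulNr mulrAC -expr2 K2 mul1r.
exact: subrr.
Qed.

Lemma tproj_sqr x y : M x -> M y -> tproj x y ⋅ tproj x y = K * (1 - (x ⋅ y) ^+ 2).
Proof.
move=> Mx My; rewrite [in X in X ⋅ _]/tproj wdotDl wdotZl wdot_tproj // mulr0 addr0.
by rewrite wdotDr wdotZr MK // (wdotC K y x); ring.
Qed.

(** A vector tangent at [x] pairs with [y] as with the projection of [y], to which Cauchy-Schwarz
    applies. *)
Lemma tangent_wdot_le x y v : M x -> M y -> x ⋅ v = 0 ->
  (v ⋅ y) ^+ 2 <= (v ⋅ v) * (K * (1 - (x ⋅ y) ^+ 2)).
Proof.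
move=> Mx My xv; rewrite -(tproj_sqr Mx My).
have -> : v ⋅ y = v ⋅ tproj x y.
  rewrite [in RHS]/tproj wdotDr wdotZr (wdotC K v x) xv.
  by rewrite mulr0 addr0.
by apply: (tangent_CauchySchwarz Mx xv); exact: wdot_tproj.
Qed.

(* Testing the form on the projection of [x] to the tangent space at [y] gives
   <v, y> = 0, so that [v] is tangent at [y] too and can be tested on itself. *)
Lemma mixed_form_nondegenerate u1 u2 x y v : M x -> M y -> x ⋅ v = 0 -> u1 != 0 ->
  - K * (x ⋅ y) * u1 + K * (1 - (x ⋅ y) ^+ 2) * u2 != 0 ->
  (forall z, y ⋅ z = 0 -> u2 * (v ⋅ y) * (x ⋅ z) + u1 * (v ⋅ z) = 0) -> v = 0.
Proof.
move=> Mx My xv u1_neq0 D_neq0 B0.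
have vy : v ⋅ y = 0.
  have /eqP := B0 _ (wdot_tproj x My).
  rewrite /tproj !wdotDr !wdotZr MK // (wdotC K v x) xv (wdotC K y x) add0r.
  set s := x ⋅ y in D_neq0 *; set a := v ⋅ y.
  have -> : u2 * a * (K + - (K * s) * s) + u1 * (- (K * s) * a) =
    a * (- K * s * u1 + K * (1 - s ^+ 2) * u2) by ring.
  by rewrite mulf_eq0 (negbTE D_neq0) orbF => /eqP.
have := B0 v; rewrite (wdotC K y v) vy => /(_ erefl) /eqP.
rewrite mulr0 mul0r add0r mulf_eq0 (negbTE u1_neq0) => /eqP.
exact: (Mpos Mx xv).2.
Qed.

End TangentAlgebra.

(** * The profile functions and the conditions on their derivatives *)

Section Profile.
Variables (R : realType) (K a r : R).

(** The k-th derivative of -(a + K s)^r. The sphere takes a = K = 1 and r = 1/alpha, the hyperboloid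
    a = 0, K = -1 and r = beta. *)
Definition profile (k : nat) (s : R) : R :=
  - (\prod_(j < k) (r - j%:R)) * K ^+ k * (a + K * s) `^ (r - k%:R).

Lemma profile0 s : profile 0 s = - ((a + K * s) `^ r).
Proof. by rewrite /profile big_ord0 expr0 mulr1 subr0 mulN1r. Qed.

Lemma is_derive_profile k s : 0 < a + K * s ->
  is_derive s 1 (profile k) (profile k.+1 s).
Proof.
move=> T0.
have dT : is_derive s 1 (fun t : R => a + K * t) (0 + (K * 1 + 0 * s)).
  exact: is_derive_addf (is_derive_cst a s 1) (is_derive_mulf
    (is_derive_cst K s 1) (is_derive_id s 1)).
have h := is_derive_mulf
  (is_derive_cst (- (\prod_(j < k) (r - j%:R)) * K ^+ k) s (1 : R))
  (is_derive_compf dT (is_derive1_powR (r - k%:R) T0)).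
have E : r - k.+1%:R = r - k%:R - 1 by rewrite -natr1 opprD addrA.
by apply: (is_derive_eq h); rewrite /profile E big_ord_recr /= exprS /cst; ring.
Qed.

Lemma profileS k s : 0 < a + K * s ->
  profile k.+1 s = (r - k%:R) * K / (a + K * s) * profile k s.
Proof.
have E : r - k.+1%:R = r - k%:R - 1 by rewrite -natr1 opprD addrA.
move=> T0; rewrite /profile E big_ord_recr /= exprS.
have -> : (a + K * s) `^ (r - k%:R - 1) = (a + K * s) `^ (r - k%:R) / (a + K * s).
  rewrite [LHS]powRD; last by rewrite (gt_eqF T0) implybT.
  by rewrite powR_inv1 ?ltW.
ring.
Qed.

Lemma Ck_profile (V : normedModType R) k (U : set V) (f : V -> R) :
  open U -> (forall x, U x -> 0 < a + K * f x) -> Ck k U f ->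
  Ck k U (fun x => profile 0 (f x)).
Proof.
move=> oU f0 Cf; under eq_fun do rewrite profile0 -mulN1r.
by apply: Ck_mul => //; [exact: Ck_cst|apply: Ck_powR => //; exact: Ck_affine].
Qed.

End Profile.

(** What strict regularity asks of the profile at one value of s. The second condition is
    nondegeneracy of the mixed Hessian; its left side is also the denominator in [cross_value]. The
    bounds on a and b are those of [tangent_wdot_le]. *)
Definition regular_values (R : realFieldType) (K s u1 u2 u3 u4 : R) : Prop :=
  [/\ u1 != 0, - K * s * u1 + K * (1 - s ^+ 2) * u2 != 0 &
   forall a b m X Y, 0 <= X -> 0 <= Y ->
     a ^+ 2 <= X * (K * (1 - s ^+ 2)) -> b ^+ 2 <= Y * (K * (1 - s ^+ 2)) ->
     u1 * m + u2 * (a * b) = 0 ->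
     let E := cross_value K s u1 u2 u3 u4 a b m X Y in
     0 <= E /\ (E = 0 -> X = 0 \/ Y = 0)].

Section Identities.
Variables (R : realFieldType) (K s u1 u2 u3 u4 a X k : R).
Hypotheses (K2 : K ^+ 2 = 1) (u1_neq0 : u1 != 0).
Hypothesis D_neq0 : - K * s * u1 + K * (1 - s ^+ 2) * u2 != 0.
Hypothesis kE : k * (- K * s * u1 + K * (1 - s ^+ 2) * u2) =
  u3 * a ^+ 2 - K * X * (s * u2 + u1) - 2 * u2 ^+ 2 / u1 * a ^+ 2.

(** The two sides differ by [xz] times the equation [kE]. *)
Lemma first_order_identity (xz xiz ey ez : R) :
  u2 * (ey + K * X * s + (2 * u2 / u1 * a * a + k * (K - K * s * s))) * xz +
  u1 * (ez + K * X * xz + (2 * u2 / u1 * a * xiz + k * (0 - K * s * xz))) =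
  u3 * a ^+ 2 * xz + u2 * (ey * xz + 2 * a * xiz) + u1 * ez.
Proof.
transitivity (u3 * a ^+ 2 * xz + u2 * (ey * xz + 2 * a * xiz) + u1 * ez + xz *
  (k * (- K * s * u1 + K * (1 - s ^+ 2) * u2) -
   (u3 * a ^+ 2 - K * X * (s * u2 + u1) - 2 * u2 ^+ 2 / u1 * a ^+ 2))).
  by field.
by rewrite kE subrr mulr0 addr0.
Qed.

(** All second derivatives of the charts cancel: up to a multiple of [kE], only first-order data
    remain. *)
Lemma second_order_identity (b m Y ey exib xeb xieb eeb : R) :
  let zy := ey + K * X * s + (2 * u2 / u1 * a * a + k * (K - K * s * s)) in
  let zxib := exib + K * X * b + (2 * u2 / u1 * a * m + k * (0 - K * s * b)) in
  let zeb := eeb + K * X * xeb + (2 * u2 / u1 * a * xieb + k * (- Y - K * s * xeb)) in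
  u3 * (zy * (b * b)) + u2 * (2 * (zxib * b) + zy * xeb) + u1 * zeb -
  (u4 * a ^+ 2 * b ^+ 2 + u3 * (ey * b ^+ 2 + a ^+ 2 * xeb + 4 * a * b * m) +
   u2 * (2 * m ^+ 2 + 2 * exib * b + 2 * a * xieb + ey * xeb) + u1 * eeb) =
  cross_value K s u1 u2 u3 u4 a b m X Y.
Proof.
rewrite /cross_value /= -kE mulfK //.
set CV := (X in _ = X).
transitivity (CV + (xeb + K * Y * s) *
  (k * (- K * s * u1 + K * (1 - s ^+ 2) * u2) -
   (u3 * a ^+ 2 - K * X * (s * u2 + u1) - 2 * u2 ^+ 2 / u1 * a ^+ 2))).
  (* The relation K^2 = 1 is used by substituting K = 1 and K = -1. *)
  rewrite /CV; move/eqP: K2; rewrite sqrf_eq1 => /orP[]/eqP->; by field.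
by rewrite kE subrr mulr0 addr0.
Qed.

End Identities.

Section ContractedVector.
Variables (R : realType) (n : nat) (K : R) (x y xi eta : 'rV[R]_n.+1).
Variables (u1 u2 u3 u4 : R).
Local Notation "v ⋅ w" := (wdot K v w) (at level 40).
Local Notation s := (x ⋅ y).
Local Notation a := (xi ⋅ y).
Local Notation X := (xi ⋅ xi).
Local Notation D := (- K * s * u1 + K * (1 - s ^+ 2) * u2).
Hypotheses (K2 : K ^+ 2 = 1) (xx : x ⋅ x = K) (yy : y ⋅ y = K).
Hypotheses (xxi : x ⋅ xi = 0) (xeta : x ⋅ eta = - X).
Hypotheses (u1_neq0 : u1 != 0) (D_neq0 : D != 0).

(** In [contracted_vector], the coefficient of [xi] matches the terms in <xi, z>; [k] is then forced
    by the terms in <x, z>. *)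
Let k := (u3 * a ^+ 2 - K * X * (s * u2 + u1) - 2 * u2 ^+ 2 / u1 * a ^+ 2) / D.

(* With [eta] the second derivative of the chart in the direction [xi], this is
   the tangent vector whose pairing with every [z] tangent at [y] is the third
   derivative c_{xi xi z}. *)
Definition contracted_vector : 'rV[R]_n.+1 :=
  eta + (K * X) *: x + ((2 * u2 / u1 * a) *: xi + k *: tproj K x y).

Let wdot_q z : contracted_vector ⋅ z = eta ⋅ z + K * X * (x ⋅ z) +
  (2 * u2 / u1 * a * (xi ⋅ z) + k * (y ⋅ z - K * s * (x ⋅ z))).
Proof. by rewrite !wdotDl !wdotZl wdotDl wdotZl mulNr. Qed.

Let kE : k * D = u3 * a ^+ 2 - K * X * (s * u2 + u1) - 2 * u2 ^+ 2 / u1 * a ^+ 2.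
Proof. by rewrite /k mulfVK. Qed.

(** Since <x, eta> = -X, the part eta + K X x is the tangential projection of [eta]; the other
    summands are tangent. *)
Lemma contracted_vector_tangent : x ⋅ contracted_vector = 0.
Proof.
rewrite wdotC wdot_q (wdotC K eta) xeta (wdotC K xi x) xxi xx (wdotC K y).
have KK t : K * t * K = t by rewrite mulrAC -expr2 K2 mul1r.
by rewrite !KK addNr mulr0 !add0r subrr mulr0.
Qed.

Lemma contracted_vector_mixed z : y ⋅ z = 0 ->
  u2 * (contracted_vector ⋅ y) * (x ⋅ z) + u1 * (contracted_vector ⋅ z) =
  u3 * a ^+ 2 * (x ⋅ z) +
  u2 * ((eta ⋅ y) * (x ⋅ z) + 2 * a * (xi ⋅ z)) + u1 * (eta ⋅ z).
Proof. by move=> yz; rewrite !wdot_q yz yy; exact: (first_order_identity u1_neq0 kE). Qed.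

Lemma contracted_vector_cross xib etab : y ⋅ xib = 0 -> y ⋅ etab = - (xib ⋅ xib) ->
  let b := x ⋅ xib in let m := xi ⋅ xib in
  u3 * ((contracted_vector ⋅ y) * (b * b)) +
  u2 * (2 * ((contracted_vector ⋅ xib) * b) + (contracted_vector ⋅ y) * (x ⋅ etab)) +
  u1 * (contracted_vector ⋅ etab) -
  (u4 * a ^+ 2 * b ^+ 2 +
   u3 * ((eta ⋅ y) * b ^+ 2 + a ^+ 2 * (x ⋅ etab) + 4 * a * b * m) +
   u2 * (2 * m ^+ 2 + 2 * (eta ⋅ xib) * b + 2 * a * (xi ⋅ etab) +
     (eta ⋅ y) * (x ⋅ etab)) +
   u1 * (eta ⋅ etab)) =
  cross_value K s u1 u2 u3 u4 a b m X (xib ⋅ xib).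
Proof.
move=> yxib yetab b m; rewrite !wdot_q yxib yetab yy.
exact (second_order_identity u4 K2 u1_neq0 D_neq0 kE b m (xib ⋅ xib)
  (eta ⋅ y) (eta ⋅ xib) (x ⋅ etab) (xi ⋅ etab) (eta ⋅ etab)).
Qed.

End ContractedVector.

Lemma open_setX (V W : topologicalType) (A : set V) (B : set W) :
  open A -> open B -> open (A `*` B).
Proof.
move=> oA oB; apply: openI; apply: open_comp => // p _.
  exact: cvg_fst.
exact: cvg_snd.
Qed.

Lemma Ck_pairing (R : realType) (l n m k : nat) (K : R) (U : set 'rV[R]_l)
    (Ub : set 'rV[R]_n) (A : 'rV[R]_l -> 'rV[R]_m.+1) (B : 'rV[R]_n -> 'rV[R]_m.+1) :
  open U -> open Ub -> smooth U A -> smooth Ub B ->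
  Ck k (U `*` Ub) (fun p : 'rV[R]_l * 'rV[R]_n => wdot K (A p.1) (B p.2)).
Proof.
move=> oU oUb CA CB; have oU2 := open_setX oU oUb.
apply: Ck_sum => // i; apply: Ck_mul => //; first exact: Ck_cst.
apply: Ck_mul => //.
  apply: (@Ck_subset _ _ _ _ (fst @^-1` U)) => [p []//|].
  apply: (@Ck_comp_linear _ _ _ _ _ U (fun y => A y 0 i) fst) => //.
    by move=> p; exact: cvg_fst.
  exact: (Ck_rowP k A oU).1 (CA k) i.
apply: (@Ck_subset _ _ _ _ (snd @^-1` Ub)) => [p []//|].
apply: (@Ck_comp_linear _ _ _ _ _ Ub (fun y => B y 0 i) snd) => //.
  by move=> p; exact: cvg_snd.
exact: (Ck_rowP k B oUb).1 (CB k) i.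
Qed.

Lemma wdot_continuous (R : realType) m (K : R) :
  continuous (fun p : 'rV[R]_m.+1 * 'rV[R]_m.+1 => wdot K p.1 p.2).
Proof.
have smooth_id : smooth [set: 'rV[R]_m.+1] id.
  by move=> k; apply/Ck_rowP => [|i]; [exact: openT|exact: Ck_coord].
move=> p; have := Ck_pairing 0 K openT openT smooth_id smooth_id.
by move=> /Ck_continuous; apply.
Qed.

(** * Strict regularity *)

Section Model.
Variables (R : realType) (n : nat) (K a r : R) (M : set 'rV[R]_n.+1).
Variables (N : set ('rV[R]_n.+1 * 'rV[R]_n.+1)).
Variables (c : 'rV[R]_n.+1 -> 'rV[R]_n.+1 -> R).
Hypothesis K2 : K ^+ 2 = 1.
Hypothesis MK : forall x, M x -> wdot K x x = K.
Hypothesis Mpos : forall x v, M x -> wdot K x v = 0 ->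
  0 <= wdot K v v /\ (wdot K v v = 0 -> v = 0).
Hypothesis NE : N = (M `*` M) `&` [set p | 0 < a + K * wdot K p.1 p.2].
Hypothesis cE : forall x y, c x y = profile K a r 0 (wdot K x y).
Hypothesis regular : forall x y, N (x, y) -> let s := wdot K x y in
  regular_values K s (profile K a r 1 s) (profile K a r 2 s)
    (profile K a r 3 s) (profile K a r 4 s).

Let K_neq0 : K != 0.
Proof.
by apply/eqP => K0; move/eqP: K2; rewrite K0 expr0n eq_sym oner_eq0.
Qed.

Section Coordinates.
Variables (U Ub : set 'rV[R]_n) (phi phib : 'rV[R]_n -> 'rV[R]_n.+1).
Hypothesis (lphi : local_param M U phi) (lphib : local_param M Ub phib).

Local Notation O := (coordinate_domain N U phi Ub phib).
Local Notation S := (pairing K phi phib).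
Local Notation C := (in_coordinates c phi phib).
Local Notation u := (profile K a r).

Let CE : C = fun p => u 0%N (S p).
Proof. by apply/funext => p; rewrite /in_coordinates cE. Qed.

Let oU2 : open (U `*` Ub).
Proof. exact: open_setX (local_param_open lphi) (local_param_open lphib). Qed.

Let Ck_S k : Ck k (U `*` Ub) S.
Proof.
apply: Ck_pairing; [exact: local_param_open lphi|exact: local_param_open lphib| |].
  exact: local_param_smooth lphi.
exact: local_param_smooth lphib.
Qed.

(** Chart points lie on [M], so that only positivity of the base of the power is left as a
    condition. *)
Let OE : O = (U `*` Ub) `&` [set p | 0 < a + K * S p].
Proof.
apply/seteqP; split=> p [[Up Ubp]]; rewrite /= NE /= => h; split=> //.
  by case: h.
by split=> //; split; [exact: (local_param_mem lphi)|exact: (local_param_mem lphib)].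
Qed.

Let oO : open O.
Proof.
rewrite OE; apply: open_gt0_continuous => // p Up.
exact: Ck_continuous (Ck_affine a K oU2 (Ck_S 0)) Up.
Qed.

Lemma Ck_in_coordinates k : Ck k O C.
Proof.
rewrite CE; apply: Ck_profile => //; first by move=> p; rewrite OE => -[].
by apply: Ck_subset (Ck_S k) => p; rewrite OE => -[].
Qed.

Let OU p : O p -> U p.1. Proof. by move=> [[]]. Qed.
Let OUb p : O p -> Ub p.2. Proof. by move=> [[]]. Qed.
Let du k p : O p -> is_derive (S p) 1 (u k) (u k.+1 (S p)).
Proof. by rewrite OE => -[_ T0]; exact: is_derive_profile. Qed.

Let Cphi := local_param_smooth lphi.
Let Cphib := local_param_smooth lphib.

(** Pairing with (0, e) isolates [v] and pairing with (e, 0) isolates [vb]. By [dirD_onto] the test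
    vectors fill the tangent spaces, so [mixed_form_nondegenerate] applies at (x, y) and at (y,
    x). *)
Lemma in_coordinates_nondegenerate p : O p -> KM_nondegenerate C p.
Proof.
move=> Op; have [u1_neq0 D_neq0 _] := regular Op.2.
have Up := OU Op; have Ubp := OUb Op.
have Mx := local_param_mem lphi Up; have My := local_param_mem lphib Ubp.
have B v e : 'D_(v, 0) ('D_(0, e) C) p =
    u 2 (S p) * pairing K (dirD v phi) phib p * pairing K phi (dirD e phib) p +
    u 1 (S p) * pairing K (dirD v phi) (dirD e phib) p.
  rewrite CE.
  by rewrite (derive_cost_fst_snd Cphi Cphib oO OU OUb du v e (mem_set Op)).
have B' e v : 'D_(0, e) ('D_(v, 0) C) p =
    u 2 (S p) * pairing K (dirD v phi) phib p * pairing K phi (dirD e phib) p +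
    u 1 (S p) * pairing K (dirD v phi) (dirD e phib) p.
  rewrite CE.
  by rewrite (derive_cost_snd_fst Cphi Cphib oO OU OUb du e v (mem_set Op)).
have D0 (f : 'rV[R]_n * 'rV[R]_n -> R) w : 'D_w ('D_(0, 0) f) p = 0.
  have -> : 'D_(0, 0) f = fun=> 0 by apply/funext => q; exact: derive0.
  exact: derive_cst.
move=> [v vb] KM0.
have KM1 e : u 2 (S p) * wdot K (dirD v phi p.1) (phib p.2) *
    wdot K (phi p.1) (dirD e phib p.2) +
    u 1 (S p) * wdot K (dirD v phi p.1) (dirD e phib p.2) = 0.
  have E := congr2 (fun s t => - 2^-1 * (s + t)) (B v e) (D0 C (0, vb)).
  have /eqP := etrans (esym E) (KM0 (0, e)); rewrite addr0.
  by rewrite mulf_eq0 oppr_eq0 invr_eq0 pnatr_eq0 /= => /eqP.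
have KM2 e : u 2 (S p) * wdot K (dirD vb phib p.2) (phi p.1) *
    wdot K (phib p.2) (dirD e phi p.1) +
    u 1 (S p) * wdot K (dirD vb phib p.2) (dirD e phi p.1) = 0.
  have E := congr2 (fun s t => - 2^-1 * (s + t)) (D0 C (v, 0)) (B' vb e).
  have /eqP := etrans (esym E) (KM0 (e, 0)); rewrite add0r.
  rewrite mulf_eq0 oppr_eq0 invr_eq0 pnatr_eq0 /= => /eqP; rewrite /pairing.
  rewrite (wdotC K (dirD e phi p.1) (phib p.2)) (wdotC K (phi p.1) (dirD vb phib p.2)).
  by rewrite (wdotC K (dirD e phi p.1)) mulrAC.
have v0 : v = 0.
  apply: (dirD_eq0 lphi Up).
  apply: (mixed_form_nondegenerate K2 MK Mpos Mx My _ u1_neq0 D_neq0).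
    exact: (wdot_dirD lphi MK).
  by move=> z yz; have [e <-] := dirD_onto lphib MK K_neq0 Ubp yz.
have vb0 : vb = 0.
  apply: (dirD_eq0 lphib Ubp).
  have D'_neq0 : - K * wdot K (phib p.2) (phi p.1) * u 1 (S p) +
      K * (1 - wdot K (phib p.2) (phi p.1) ^+ 2) * u 2 (S p) != 0.
    by rewrite (wdotC K (phib p.2)).
  apply: (mixed_form_nondegenerate K2 MK Mpos My Mx _ u1_neq0 D'_neq0).
    exact: (wdot_dirD lphib MK).
  by move=> z xz; have [e <-] := dirD_onto lphi MK K_neq0 Up xz.
by rewrite v0 vb0.
Qed.

(** The contracted vector is tangent, hence the image of some coordinate vector [q], and this [q]
    meets the requirement of [cross_derive]. *)
Lemma cross_in_coordinates p w : O p ->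
  let s := S p in
  let X := wdot K (dirD w.1 phi p.1) (dirD w.1 phi p.1) in
  let Y := wdot K (dirD w.2 phib p.2) (dirD w.2 phib p.2) in
  let b := wdot K (phi p.1) (dirD w.2 phib p.2) in
  let a := wdot K (dirD w.1 phi p.1) (phib p.2) in
  let m := wdot K (dirD w.1 phi p.1) (dirD w.2 phib p.2) in
  cross C p w = 2^-1 * cross_value K s (u 1 s) (u 2 s) (u 3 s) (u 4 s) a b m X Y.
Proof.
move=> Op s X Y b a' m; have [u1_neq0 D_neq0 _] := regular Op.2.
have Up := OU Op; have Ubp := OUb Op.
have xx := MK (local_param_mem lphi Up); have yy := MK (local_param_mem lphib Ubp).
have Oin := mem_set Op.
have xxi := wdot_dirD lphi MK w.1 Up; have xeta := wdot_dirD2 lphi MK w.1 Up.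
have yxib := wdot_dirD lphib MK w.2 Ubp; have yetab := wdot_dirD2 lphib MK w.2 Ubp.
have xz := contracted_vector_tangent (phib p.2) (u 1 s) (u 2 s) (u 3 s) K2 xx xxi xeta.
have [q qE] := dirD_onto lphi MK K_neq0 Up xz.
have B3 f : 'D_(q, 0) (pdbar f C) p = 'D_(w.1, 0) ('D_(w.1, 0) (pdbar f C)) p.
  rewrite CE /pdbar.
  apply: etrans (derive_cost_fst_snd Cphi Cphib oO OU OUb du q _ Oin) _.
  apply: etrans _ (esym (derive_cost_fst2_snd Cphi Cphib oO OU OUb du w.1 _ Oin)).
  rewrite /pairing qE.
  exact: (contracted_vector_mixed _ _ _ yy u1_neq0 D_neq0 (wdot_dirD lphib MK _ Ubp)).
apply: etrans (cross_derive oO Op (Ck_in_coordinates 4)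
  (in_coordinates_nondegenerate Op) B3) _; congr (_ * _).
rewrite CE.
have E1 := derive_cost_fst_snd2 Cphi Cphib oO OU OUb du q w.2 Oin.
have E2 := derive_cost_fst2_snd2 Cphi Cphib oO OU OUb du w.1 w.2 Oin.
apply: etrans (congr2 (fun t t' => t - t') E1 E2) _.
rewrite /pairing qE.
exact: (contracted_vector_cross _ _ _ (u 4 s) K2 yy u1_neq0 D_neq0 yxib yetab).
Qed.


Lemma in_coordinates_regular p w : O p -> null_vector C p w ->
  0 <= cross C p w /\ (cross C p w = 0 -> w.1 = 0 \/ w.2 = 0).
Proof.
move=> Op null; have Oin := mem_set Op.
have Up := OU Op; have Ubp := OUb Op.
have Mx := local_param_mem lphi Up; have My := local_param_mem lphib Ubp.
have xxi := wdot_dirD lphi MK w.1 Up; have yxib := wdot_dirD lphib MK w.2 Ubp.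
have [X0 Xeq0] := Mpos Mx xxi; have [Y0 Yeq0] := Mpos My yxib.
(* The two mixed derivatives in [KM] have the same formula, so nullity means that this common value
   vanishes. *)
have null' : u 1 (S p) * wdot K (dirD w.1 phi p.1) (dirD w.2 phib p.2) +
    u 2 (S p) * (wdot K (dirD w.1 phi p.1) (phib p.2) *
      wdot K (phi p.1) (dirD w.2 phib p.2)) = 0.
  have E1 := derive_cost_fst_snd Cphi Cphib oO OU OUb du w.1 w.2 Oin.
  have E2 := derive_cost_snd_fst Cphi Cphib oO OU OUb du w.2 w.1 Oin.
  move: null; rewrite /null_vector /KM CE => null.
  have half0 (t : R) : - 2^-1 * (t + t) = 0 -> t = 0.
    move=> /eqP; rewrite mulf_eq0 oppr_eq0 invr_eq0 pnatr_eq0 -mulr2n mulrn_eq0.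
    exact: eqP.
  rewrite addrC mulrA; apply: half0.
  exact: etrans (esym (congr2 (fun s t => - 2^-1 * (s + t)) E1 E2)) null.
(* The bound on b is the one on a with the two points exchanged. *)
have bound_b := tangent_wdot_le K2 MK Mpos My Mx yxib.
rewrite (wdotC K (phib p.2)) (wdotC K _ (phi p.1)) in bound_b.
have [_ _ reg] := regular Op.2.
have [h1 h2] := reg _ _ _ _ _ X0 Y0 (tangent_wdot_le K2 MK Mpos Mx My xxi)
  (bound_b) null'.
rewrite (cross_in_coordinates w Op); split; first by rewrite mulr_ge0 // invr_ge0.
move=> /eqP; rewrite mulf_eq0 invr_eq0 pnatr_eq0 /= => /eqP /h2 [/Xeq0|/Yeq0] z0.
  by left; exact: (dirD_eq0 lphi Up).
by right; exact: (dirD_eq0 lphib Ubp).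
Qed.

End Coordinates.
Lemma model_KM_cost : submanifold n M -> KM_cost n M M N c.
Proof.
move=> subM; split=> //.
- exists [set p | 0 < a + K * wdot K p.1 p.2]; last exact: NE.
  rewrite -(setTI [set p | _]); apply: open_gt0_continuous => [|p _].
    exact: openT.
  apply: cvgD; first exact: cvg_cst.
  by apply: cvgM; [exact: cvg_cst|exact: wdot_continuous].
- by move=> U phi Ub phib lphi lphib; exact: Ck_in_coordinates.
- move=> U phi Ub phib lphi lphib p Op.
  exact: (in_coordinates_nondegenerate lphi lphib Op).
Qed.

Lemma model_A3s : A3s n M M N c.
Proof.
split=> U phi Ub phib lphi lphib p Op w null.
  exact: (in_coordinates_regular lphi lphib Op null).1.
exact: (in_coordinates_regular lphi lphib Op null).2.
Qed.

End Model.

(** * The sphere *)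

Section Sphere.
Variables (R : realType) (n : nat).
Implicit Types x y v : 'rV[R]_n.+1.

Lemma sphere_wdot x : sphere R n x -> wdot 1 x x = 1.
Proof. by rewrite /sphere /= dot_wdot. Qed.

Lemma wdot1_definite v : 0 <= wdot 1 v v /\ (wdot 1 v v = 0 -> v = 0).
Proof.
have E : wdot 1 v v = \sum_i v 0 i ^+ 2.
  by rewrite -dot_wdot; apply: eq_bigr => i _; rewrite expr2.
rewrite E; split; first by apply: sumr_ge0 => i _; rewrite sqr_ge0.
move=> /eqP; rewrite psumr_eq0 => [|i _]; last exact: sqr_ge0.
move=> /allP v0; apply/rowP => i; rewrite mxE; apply/eqP.
by have := v0 i (mem_index_enum i); rewrite /= sqrf_eq0.
Qed.

(** On the sphere <x + y, x + y> = 2 (1 + <x, y>), which is positive unless y = -x. *)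
Lemma sphere_starE : sphere_star R n =
  (sphere R n `*` sphere R n) `&` [set p | 0 < 1 + 1 * wdot 1 p.1 p.2].
Proof.
apply/seteqP; split=> -[x y] [[Mx My] h]; split=> //=; rewrite ?mul1r.
  have [xy_ge0 xy0] := wdot1_definite (x + y).
  have E : wdot 1 (x + y) (x + y) = 2 * (1 + wdot 1 x y).
    rewrite wdotDl !wdotDr (sphere_wdot Mx) (sphere_wdot My) (wdotC _ y x).
    by ring.
  rewrite lt_neqAle; apply/andP; split; last by rewrite E pmulr_rge0 in xy_ge0.
  apply/eqP => s0; apply: h; exists x => //; congr pair.
  by apply/eqP; rewrite eq_sym -addr_eq0 addrC xy0 // E -s0 mulr0.
move=> [z Mz [zx zy]]; move: h; rewrite /= -zx -zy mul1r.
by rewrite (wdotC _ z) wdotNl (sphere_wdot Mz) subrr ltxx.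
Qed.

(** Each point is covered by projecting from a pole not in its own open hemisphere, e having the
    sign of x_0. *)
Lemma sphere_submanifold : submanifold n (sphere R n).
Proof.
apply: (@stereographic_submanifold _ _ 1) => [||x Mx].
- exact: expr1n.
- exact: sphere_wdot.
have chartM (e : R) : e ^+ 2 = 1 ->
    forall z, chart_dom 1 z -> sphere R n (chart 1 e z).
  by move=> e2 z Uz; rewrite /sphere /= dot_wdot wdot_chart ?expr1n.
have [x0|x0] := lerP 0 (x 0 ord0).
  exists 1; first exact: expr1n.
  by split; [rewrite /chart_codom /= mul1r ltr_wpDr|exact/chartM/expr1n].
exists (-1); first by rewrite sqrrN expr1n.
split; last by apply: chartM; rewrite sqrrN expr1n.
by rewrite /chart_codom /= mulN1r ltr_wpDr // oppr_ge0 ltW.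
Qed.

(** The recursive shape of u2, u3, u4 is the one produced by [profileS] for a = K = 1. *)
Lemma sphere_regular (g s u1 : R) :
  0 < g -> g <= 2^-1 -> 0 < 1 + s -> s <= 1 -> u1 < 0 ->
  let u2 := (g - 1) * 1 / (1 + 1 * s) * u1 in
  let u3 := (g - 2) * 1 / (1 + 1 * s) * u2 in
  let u4 := (g - 3) * 1 / (1 + 1 * s) * u3 in
  regular_values 1 s u1 u2 u3 u4.
Proof.
move=> g0 g2 t0 s1 u1_lt0 u2 u3 u4.
have t_neq0 : 1 + s != 0 by rewrite gt_eqF.
have e2 : u2 = - (1 - g) / (1 + s) * u1 by rewrite /u2; field.
have e3 : u3 = (1 - g) * (1 + (1 - g)) / (1 + s) ^+ 2 * u1.
  by rewrite /u3 /u2; field.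
have e4 : u4 = - ((1 - g) * (1 + (1 - g)) * (2 + (1 - g))) / (1 + s) ^+ 3 * u1.
  by rewrite /u4 /u3 /u2; field.
rewrite e2 e3 e4; split; first by rewrite lt_eqF.
  have -> : - 1 * s * u1 + 1 * (1 - s ^+ 2) * (- (1 - g) / (1 + s) * u1) =
    - u1 * (g * s + (1 - g)) by field.
  apply: mulf_neq0; first by rewrite oppr_eq0 lt_eqF.
  by apply: lt0r_neq0; nra.
move=> a b m X Y X0 Y0; rewrite mul1r => ha hb null.
exact: sphere_cross_value.
Qed.

Lemma sphere_profiles_inverse (alpha : R) : 2 <= alpha ->
  mutually_inverse `[-1, 1]%classic `[- (2 `^ alpha^-1), 0]%classic
    (sphere_u alpha) (sphere_s alpha).
Proof.
move=> alpha2; have alpha0 : 0 < alpha by lra.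
have alpha_neq0 : alpha != 0 by rewrite gt_eqF.
have alphaV0 : 0 < alpha^-1 by rewrite invr_gt0.
split=> [s|u|s|u]; rewrite ?inE /= !in_itv /= => /andP[h1 h2].
- rewrite /sphere_u oppr_le0 powR_ge0 andbT lerN2.
  by apply: ge0_ler_powR; rewrite ?nnegrE ?(ltW alphaV0) //; lra.
- have u0 : 0 <= - u by rewrite oppr_ge0.
  rewrite /sphere_s -{1}[-1]add0r lerD2r powR_ge0 /= lerBlDr.
  have -> : 1 + 1 = (2 `^ alpha^-1) `^ alpha :> R.
    by rewrite -powRrM mulVf // powRr1 //; lra.
  by apply: ge0_ler_powR; rewrite ?nnegrE ?powR_ge0 ?(ltW alpha0) // lerNl.
- by rewrite /sphere_s /sphere_u opprK -powRrM mulVf // powRr1; lra.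
- rewrite /sphere_u /sphere_s [1 + _]addrC subrK -powRrM mulfV // powRr1 ?opprK //.
  by rewrite oppr_ge0.
Qed.

Lemma sphere_cost_regular (alpha : R) : 2 <= alpha ->
  KM_cost n (sphere R n) (sphere R n) (sphere_star R n) (sphere_cost alpha) /\
  A3s n (sphere R n) (sphere R n) (sphere_star R n) (sphere_cost alpha).
Proof.
move=> alpha2; have alpha0 : 0 < alpha by lra.
have K2 : 1 ^+ 2 = 1 :> R by exact: expr1n.
have Mpos x v : sphere R n x -> wdot 1 x v = 0 ->
    0 <= wdot 1 v v /\ (wdot 1 v v = 0 -> v = 0) by move=> _ _; exact: wdot1_definite.
have cE x y : sphere_cost alpha x y = profile 1 1 alpha^-1 0 (wdot 1 x y).
  by rewrite profile0 /sphere_cost /sphere_u dot_wdot mul1r.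
have reg x y : sphere_star R n (x, y) -> let s := wdot 1 x y in
    regular_values 1 s (profile 1 1 alpha^-1 1 s) (profile 1 1 alpha^-1 2 s)
      (profile 1 1 alpha^-1 3 s) (profile 1 1 alpha^-1 4 s).
  rewrite sphere_starE => -[[Mx My]] /= T0.
  have T0' : 0 < 1 + wdot 1 x y by rewrite -[wdot 1 x y]mul1r.
  rewrite (profileS _ 3 T0) (profileS _ 2 T0) (profileS _ 1 T0).
  apply: sphere_regular => //.
  - by rewrite invr_gt0.
  - by rewrite lef_pV2 ?posrE //.
  (* The bound s <= 1 follows because the projection of y has square 1 - s^2. *)
  - have [+ _] := wdot1_definite (tproj 1 x y).
    rewrite (tproj_sqr K2 sphere_wdot Mx My) mul1r subr_ge0.
    rewrite !leNgt => /negP sq; apply/negP => s_gt1; apply: sq.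
    by rewrite exprn_egt1.
  - rewrite /profile big_ord1 subr0 expr1 mulr1 mulNr oppr_lt0.
    by rewrite mulr_gt0 ?invr_gt0 ?powR_gt0.
split.
  exact: (model_KM_cost K2 sphere_wdot Mpos sphere_starE cE reg sphere_submanifold).
exact: (model_A3s K2 sphere_wdot Mpos sphere_starE cE reg).
Qed.

End Sphere.

(** * The hyperboloid *)

Section Hyperboloid.
Variables (R : realType) (n : nat).
Implicit Types x y v : 'rV[R]_n.+1.

Lemma hyperboloid_wdot x : hyperboloid R n x -> wdot (-1) x x = -1.
Proof. by move=> [+ _]; rewrite lorentz_wdot. Qed.

Lemma hyperboloid_sqr x : hyperboloid R n x ->
  \sum_(i < n) x 0 (lift ord0 i) ^+ 2 = x 0 ord0 ^+ 2 - 1.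
Proof.
move=> /hyperboloid_wdot; rewrite wdot_recl mulN1r => <-.
rewrite addrA subrr add0r; exact: eq_bigr.
Qed.

Lemma sum_sqrB (I : finType) (f g : I -> R) (p q : R) :
  \sum_i (p * f i - q * g i) ^+ 2 =
  p ^+ 2 * (\sum_i f i ^+ 2) - 2 * p * q * (\sum_i f i * g i) +
  q ^+ 2 * (\sum_i g i ^+ 2).
Proof.
rewrite !mulr_sumr -sumrB -big_split /=; apply: eq_bigr => i _; ring.
Qed.

(** With p = x_0, q = y_0 and E the spatial product, the sum of the squares (q x_i - p y_i)^2 is 2
    p^2 q^2 - p^2 - q^2 - 2 p q E, which would be negative if E >= p q. *)
Lemma hyperboloid_wdot_lt0 x y : hyperboloid R n x -> hyperboloid R n y ->
  wdot (-1) x y < 0.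
Proof.
move=> Mx My; have xE := hyperboloid_sqr Mx; have yE := hyperboloid_sqr My.
have [_ x0] := Mx; have [_ y0] := My; rewrite wdot_recl mulN1r addrC subr_lt0.
have : 0 <= \sum_(i < n) (y 0 ord0 * x 0 (lift ord0 i) -
    x 0 ord0 * y 0 (lift ord0 i)) ^+ 2.
  by apply: sumr_ge0 => i _; rewrite sqr_ge0.
rewrite sum_sqrB xE yE.
set E := \sum_i _; set p := x 0 ord0 in x0 *; set q := y 0 ord0 in y0 *.
move=> h; rewrite ltNge; apply/negP => pqE; move: h; apply/negP; rewrite -ltNge.
have pq0 : 0 < p * q by exact: mulr_gt0.
have p20 : 0 < p ^+ 2 by rewrite exprn_gt0.
have q20 : 0 < q ^+ 2 by rewrite exprn_gt0.
have le : (p * q) * (p * q) <= (p * q) * E by rewrite ler_pM2l.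
clear -p20 q20 le; nra.
Qed.

(** For c = v_0/x_0 the vector v - c x has no 0-th coordinate, so its square is a sum of squares;
    orthogonality and <x, x> = -1 make it <v, v> - c^2. *)
Lemma hyperboloid_tangent_definite x v : hyperboloid R n x -> wdot (-1) x v = 0 ->
  0 <= wdot (-1) v v /\ (wdot (-1) v v = 0 -> v = 0).
Proof.
move=> Mx; have xE := hyperboloid_sqr Mx; have [_ x0] := Mx.
rewrite !wdot_recl !mulN1r => /eqP; rewrite addrC subr_eq0 => /eqP xv.
have x_neq0 : x 0 ord0 != 0 by rewrite gt_eqF.
pose c := v 0 ord0 / x 0 ord0.
have -> : - (v 0 ord0 * v 0 ord0) +
    \sum_(i < n) v 0 (lift ord0 i) * v 0 (lift ord0 i) =
    \sum_(i < n) (1 * v 0 (lift ord0 i) - c * x 0 (lift ord0 i)) ^+ 2 + c ^+ 2.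
  rewrite sum_sqrB xE; under [X in _ - _ * X]eq_bigr do rewrite mulrC.
  rewrite xv; under [X in - _ + X]eq_bigr do rewrite -expr2.
  by rewrite /c; field.
have sq0 : 0 <= \sum_(i < n) (1 * v 0 (lift ord0 i) - c * x 0 (lift ord0 i)) ^+ 2.
  by apply: sumr_ge0 => i _; rewrite sqr_ge0.
split; first by rewrite addr_ge0 ?sqr_ge0.
move=> /eqP; rewrite paddr_eq0 ?sqr_ge0 // => /andP[+ c20].
have c0 : c = 0 by apply/eqP; rewrite -sqrf_eq0.
rewrite psumr_eq0 => [|i _]; last exact: sqr_ge0.
move=> /allP v0; apply/rowP => i; rewrite mxE; case: (unliftP ord0 i) => [j ->|->].
  have := v0 j (mem_index_enum j); rewrite /= sqrf_eq0 c0 mul0r subr0 mul1r.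
  exact: eqP.
have -> : v 0 ord0 = c * x 0 ord0 by rewrite /c divfK.
by rewrite c0 mul0r.
Qed.

(** One chart suffices: x_0 > 0 puts every point in the codomain for e = 1, and on the unit ball
    chart_0 = (1 + |y|^2)/(1 - |y|^2) is positive. *)
Lemma hyperboloid_submanifold : submanifold n (hyperboloid R n).
Proof.
apply: (@stereographic_submanifold _ _ (-1)) => [||x Mx].
- by rewrite sqrrN expr1n.
- exact: hyperboloid_wdot.
have [_ x0] := Mx; exists 1; first exact: expr1n.
split; first by rewrite /chart_codom /= mul1r addr_gt0.
move=> y Uy; split.
  by rewrite lorentz_wdot wdot_chart ?sqrrN ?expr1n.
rewrite chart0 // divr_gt0 // mul1r mulN1r opprK.
by rewrite ltr_pwDl // normsq_ge0.
Qed.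

Lemma hyperboloid_regular (be s u1 : R) :
  1 <= be <= 2 -> s <= -1 -> 0 < u1 ->
  let u2 := (be - 1) * -1 / (0 + -1 * s) * u1 in
  let u3 := (be - 2) * -1 / (0 + -1 * s) * u2 in
  let u4 := (be - 3) * -1 / (0 + -1 * s) * u3 in
  regular_values (-1) s u1 u2 u3 u4.
Proof.
move=> be12 s1 u1_gt0 u2 u3 u4.
have s_neq0 : s != 0 by rewrite lt_eqF //; lra.
have e2 : u2 = (be - 1) / s * u1 by rewrite /u2; field.
have e3 : u3 = (be - 1) * (be - 1 - 1) / s ^+ 2 * u1 by rewrite /u3 /u2; field.
have e4 : u4 = (be - 1) * (be - 1 - 1) * (be - 1 - 2) / s ^+ 3 * u1.
  by rewrite /u4 /u3 /u2; field.
rewrite e2 e3 e4; split; first by rewrite gt_eqF.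
  have -> : - (-1) * s * u1 + -1 * (1 - s ^+ 2) * ((be - 1) / s * u1) =
    u1 * (1 + be * (s ^+ 2 - 1)) / s by field.
  apply: mulf_neq0; last by rewrite invr_eq0.
  apply: mulf_neq0; first by rewrite gt_eqF.
  have s2 : 0 <= s ^+ 2 - 1 by nra.
  move: be12 => /andP[be1 _].
  by apply: lt0r_neq0; rewrite ltr_pwDl // mulr_ge0 //; lra.
move=> a b m X Y X0 Y0; rewrite mulN1r opprB => ha hb null.
exact: hyperboloid_cross_value.
Qed.

Lemma hyperboloid_profiles_inverse (beta : R) : 1 <= beta <= 2 ->
  mutually_inverse `]-oo, -1]%classic `]-oo, -1]%classic
    (hyperboloid_u beta) (hyperboloid_s beta).
Proof.
move=> /andP[beta1 _]; have beta0 : 0 < beta by lra.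
have beta_neq0 : beta != 0 by rewrite gt_eqF.
have le1 (p s : R) : 0 <= p -> s <= -1 -> - ((- s) `^ p) <= -1.
  move=> p0 s1; rewrite lerN2 (_ : 1 = 1 `^ p); last by rewrite powR1.
  by apply: ge0_ler_powR => //; rewrite ?nnegrE; lra.
split=> [s|u|s|u]; rewrite ?inE /= !in_itv /= => h.
- by apply: le1 => //; lra.
- by apply: le1 => //; rewrite invr_ge0; lra.
- rewrite /hyperboloid_u /hyperboloid_s opprK -powRrM mulfV // powRr1 ?opprK //.
  by lra.
- rewrite /hyperboloid_u /hyperboloid_s opprK -powRrM mulVf // powRr1 ?opprK //.
  by lra.
Qed.

(** Brings the product into the shape required of [N] in the common model. *)
Lemma hyperboloid_setXE : hyperboloid R n `*` hyperboloid R n =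
  (hyperboloid R n `*` hyperboloid R n) `&`
  [set p | 0 < 0 + -1 * wdot (-1) p.1 p.2].
Proof.
apply/esym/setIidl => -[x y] [/= Mx My].
by rewrite add0r mulN1r oppr_gt0 hyperboloid_wdot_lt0.
Qed.

Lemma hyperboloid_cost_regular (beta : R) : 1 <= beta <= 2 ->
  KM_cost n (hyperboloid R n) (hyperboloid R n)
    (hyperboloid R n `*` hyperboloid R n) (hyperboloid_cost beta) /\
  A3s n (hyperboloid R n) (hyperboloid R n)
    (hyperboloid R n `*` hyperboloid R n) (hyperboloid_cost beta).
Proof.
move=> beta12; have K2 : (-1) ^+ 2 = 1 :> R by rewrite sqrrN expr1n.
have cE x y : hyperboloid_cost beta x y = profile (-1) 0 beta 0 (wdot (-1) x y).
  by rewrite profile0 /hyperboloid_cost /hyperboloid_u lorentz_wdot add0r mulN1r.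
have reg x y : (hyperboloid R n `*` hyperboloid R n) (x, y) ->
    let s := wdot (-1) x y in
    regular_values (-1) s (profile (-1) 0 beta 1 s) (profile (-1) 0 beta 2 s)
      (profile (-1) 0 beta 3 s) (profile (-1) 0 beta 4 s).
  move=> [/= Mx My]; have s_lt0 := hyperboloid_wdot_lt0 Mx My.
  have T0 : 0 < 0 + -1 * wdot (-1) x y by rewrite add0r mulN1r oppr_gt0.
  rewrite (profileS _ 3 T0) (profileS _ 2 T0) (profileS _ 1 T0).
  apply: hyperboloid_regular => //.
  (* The projection of y has square s^2 - 1 >= 0, and s < 0 then gives s <= -1. *)
  - have xt := wdot_tproj K2 hyperboloid_wdot y Mx.
    have [+ _] := hyperboloid_tangent_definite Mx xt.
    rewrite (tproj_sqr K2 hyperboloid_wdot Mx My) mulN1r oppr_ge0 subr_le0.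
    rewrite -sqrrN => sq; rewrite -lerN2 opprK leNgt; apply/negP => s_gt.
    move: sq; rewrite leNgt => /negP; apply.
    by rewrite exprn_ilt1 // oppr_ge0 ltW.
  - rewrite /profile big_ord1 subr0 expr1 mulrN1 opprK.
    by move: beta12 => /andP[beta1 _]; rewrite mulr_gt0 ?powR_gt0 //; lra.
split.
  exact: (model_KM_cost K2 hyperboloid_wdot hyperboloid_tangent_definite
    hyperboloid_setXE cE reg hyperboloid_submanifold).
exact: (model_A3s K2 hyperboloid_wdot hyperboloid_tangent_definite
  hyperboloid_setXE cE reg).
Qed.

End Hyperboloid.

Theorem theorem4 (R : realType) (n : nat) :
  (forall alpha : R, 2 <= alpha ->
     [/\ mutually_inverse `[-1, 1]%classic `[- (2 `^ alpha^-1), 0]%classic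
           (sphere_u alpha) (sphere_s alpha),
         KM_cost n (sphere R n) (sphere R n) (sphere_star R n)
           (sphere_cost alpha)
       & A3s n (sphere R n) (sphere R n) (sphere_star R n)
           (sphere_cost alpha)]) /\
  (forall beta : R, 1 <= beta <= 2 ->
     [/\ mutually_inverse `]-oo, -1]%classic `]-oo, -1]%classic
           (hyperboloid_u beta) (hyperboloid_s beta),
         KM_cost n (hyperboloid R n) (hyperboloid R n)
           (hyperboloid R n `*` hyperboloid R n) (hyperboloid_cost beta)
       & A3s n (hyperboloid R n) (hyperboloid R n)
           (hyperboloid R n `*` hyperboloid R n) (hyperboloid_cost beta)]).
Proof.
split=> [alpha alpha2|beta beta12].
  have [h1 h2] := sphere_cost_regular n alpha2.
  by split=> //; exact: sphere_profiles_inverse.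
have [h1 h2] := hyperboloid_cost_regular n beta12.
by split=> //; exact: hyperboloid_profiles_inverse.
Qed.
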